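(* Let $H$ be a real Hilbert space, let $A:H\to 2^{H}$ be maximal monotone, and let $B:H\to H$ be $\beta$-cocoercive for some $\beta>0$. Suppose that $\Omega:=\operatorname{zer}(A+B)\neq\emptyset$. Let $\alpha>0$, let $\{\eta_k\}_{k\in\mathbb N}\in \ell^1_+(\mathbb N)$, and let $\{U_k\}_{k\in\mathbb N}\subset\mathcal P_\alpha(H)$ be such that $$\mu:=\sup_{k\in\mathbb N}\|U_k\|<+\infty\quad\text{and}\quad (1+\eta_k)U_{k+1}\succeq U_k\quad\forall k\in\mathbb N.$$ Let $\{\gamma_k\}$ be real numbers with $\gamma_k\in(0,\frac{2\beta}{\|U_k\|})$ and let $\{\lambda_k\}$ be real numbers with $\lambda_k\in(0,\frac1{\alpha_k})$, where $\alpha_k=\frac{2\beta}{4\beta-\gamma_k\|U_k\|}$, for all $k\in\mathbb N$. Let $\{a_k\}$ and $\{b_k\}$ be sequences in $H$ such that $\sum_{k=0}^{+\infty}\lambda_k\|a_k\|<+\infty$ and $\sum_{k=0}^{+\infty}\lambda_k\|b_k\|<+\infty$. Let $x_0\in H$ and, for $k\in\mathbb N$, set $$y_k=x_k-\gamma_kU_k(Bx_k+b_k),\qquad x_{k+1}=x_k+\lambda_k\big(J_{\gamma_kU_kA}(y_k)+a_k-x_k\big).$$ Then: (i) For any $x^*\in\Omega$, $\lim_{k\to+\infty}\|x_k-x^*\|_{U_k^{-1}}$ exists. Suppose in addition that (a) $\sum_{k=0}^{+\infty}\lambda_k\big(\frac1{\alpha_k}-\lambda_k\big)=+\infty$; (b)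 $0<\underline\gamma\le\gamma_k\le\frac{2\beta-\epsilon}{\mu}$ for all $k$, where $\underline\gamma$ and $\epsilon$ are constants with $\epsilon\in(0,2\beta-\mu\underline\gamma)$; (c) $\sum_{k=0}^{+\infty}|\gamma_{k+1}-\gamma_k|<+\infty$, $\sum_{k=0}^{+\infty}\big|\gamma_{k+1}\|U_{k+1}\|-\gamma_k\|U_k\|\big|<+\infty$, and $\sum_{k=0}^{+\infty}\|U_k^{-1}x-U_{k+1}^{-1}x\|<+\infty$ for any $x\in H$. Then: (ii) $\lim_{k\to+\infty}\|x_k-J_{\gamma_kU_kA}(x_k-\gamma_kU_kBx_k)\|=0$; (iii) $\{x_k\}$ converges weakly to a point in $\Omega$. Suppose further, in addition to all of the preceding, that $\lambda_k\ge\underline\lambda>0$ for all $k$ for some constant $\underline\lambda$. Then: (iv) $Bx_k\to Bx^*$ strongly as $k\to+\infty$, where $x^*\in\Omega$.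
   Context: $\mathbb N$ is the set of nonnegative integers, and $\ell^1_+(\mathbb N)$ is the set of summable sequences in $[0,+\infty)$. $B:H\to H$ is $\beta$-cocoercive if $\langle x-y,Bx-By\rangle\ge\beta\|Bx-By\|^2$ for all $x,y\in H$. $\operatorname{zer}(A+B)=\{x\in H: 0\in Ax+Bx\}$. For bounded self-adjoint linear operators $U,V$ on $H$, $U\succeq V$ means $\langle Ux,x\rangle\ge\langle Vx,x\rangle$ for all $x\in H$; $\mathcal P_\alpha(H)$ is the set of bounded self-adjoint linear operators $U$ on $H$ with $U\succeq\alpha I$ ($I$ is the identity). $\|U\|$ is the operator norm. For $U\in\mathcal P_\alpha(H)$ with $\alpha>0$, $\|x\|_{U^{-1}}=\sqrt{\langle U^{-1}x,x\rangle}$. For $\gamma>0$, $J_{\gamma UA}=(I+\gamma UA)^{-1}$ is the resolvent of $\gamma UA$, where $(UA)x=\{Uu:u\in Ax\}$; it is single-valued and defined on all of $H$. *)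

(* Defs.v *)
From HB Require Import structures.
From mathcomp Require Import all_boot all_order all_algebra.
From mathcomp Require Import all_classical all_reals.
From mathcomp Require Import topology normedtype sequences.

Set Implicit Arguments.
Unset Strict Implicit.
Unset Printing Implicit Defensive.

Import Order.TTheory GRing.Theory Num.Theory.
Import numFieldNormedType.Exports.

Local Open Scope classical_set_scope.
Local Open Scope ring_scope.

(* A real Hilbert space is a complete normed module over R whose norm is
   induced by an inner product, i.e. by a symmetric positive definite bilinear
   form ([{dot V for idfun}]). *)
HB.mixin Record CompleteNormedModule_isHilbert (R : realType) V
    of CompleteNormedModule R V := {
  inner : {dot V for idfun} ;
  normr_inner : forall x : V, `|x| = Num.sqrt (inner x x)
}.

#[short(type="hilbertType")]
HB.structure Definition Hilbert (R : realType) :=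
  {V of CompleteNormedModule_isHilbert R V & CompleteNormedModule R V}.

Section HilbertOperators.
Variables (R : realType) (H : hilbertType R).

Local Notation "'[ x , y ]" := (@inner R H x y).

Implicit Types (A : H -> set H) (B T : H -> H) (U : {linear H -> H}).

Definition graph_le (A A' : H -> set H) := forall x, A x `<=` A' x.

Definition monotone A :=
  forall x y u v, A x u -> A y v -> 0 <= '[x - y, u - v].

Definition maximal_monotone A :=
  monotone A /\
  forall A' : H -> set H, monotone A' -> graph_le A A' -> graph_le A' A.

Definition cocoercive (beta : R) B :=
  forall x y, beta * `|B x - B y| ^+ 2 <= '[x - y, B x - B y].

Definition add_op A B : H -> set H := fun x => [set u + B x | u in A x].

Definition zer A : set H := [set x | A x 0].

Definition loewner_ge (S T : H -> H) := forall x, '[T x, x] <= '[S x, x].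

Definition self_adjoint T := forall x y, '[T x, y] = '[x, T y].

Definition Pclass (alpha : R) U :=
  [/\ bounded_fun_norm U, self_adjoint U & loewner_ge U (alpha \*: idfun)].

Definition opnorm U : R := sup [set `|U x| | x in [set x : H | `|x| <= 1]].

(* The two-sided inverse when [T] is bijective; an element of the preimage is
   chosen, with junk value 0 when the preimage is empty. *)
Definition inv_op T : H -> H := fun y => xget 0 [set x | T x = y].

Definition wnorm T (x : H) : R := Num.sqrt '[T x, x].

Definition image_op (T : H -> H) A : H -> set H := fun x => T @` A x.

(* (I + A)^-1 as a function: a chosen x with y \in x + A x, which is the only
   one when the resolvent is single-valued; junk value 0 if there is none. *)
Definition resolvent A : H -> H :=
  fun y => xget 0 [set x | add_op A idfun x y].

Definition weak_cvg (x : nat -> H) (p : H) :=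
  forall y, '[x k, y] @[k --> \oo] --> '[p, y].

End HilbertOperators.

(* Main.v *)
Require Import Defs.
From HB Require Import structures.
From mathcomp Require Import all_boot all_order all_algebra.
From mathcomp Require Import all_classical all_reals.
From mathcomp Require Import topology normedtype sequences exp.
From mathcomp Require Import ring lra.

Set Implicit Arguments.
Unset Strict Implicit.
Unset Printing Implicit Defensive.

Import Order.TTheory GRing.Theory Num.Theory.
Import numFieldNormedType.Exports.

Local Open Scope classical_set_scope.
Local Open Scope ring_scope.

(** The iterate x k.+1 is an approximate relaxation, in the metric of the inverse
    Q k of U k, of the forward-backward map T k.  By Minty's theorem the
    resolvent in T k is defined everywhere; that theorem is obtained by
    minimising the Fitzpatrick function of A plus a quadratic form ([minty]).

    Quasi-Fejer monotonicity.  Write v = x - T x, s = T x - x* and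
    d = B x - B x*.  Monotonicity of A and cocoercivity of B show that a step
    with relaxation parameter l decreases the squared Q-distance to x* by at
    least l times a nonnegative gap ([relaxed_decrease], [descent_gap_ge0]).
    The errors are summable in the metrics, and passing from Q k to Q k.+1
    costs a factor 1 + eta k because inversion reverses the Loewner order
    ([inv_loewner]).  Hence the distances converge ([wnorm_dist_cvgn]) and the
    sum of lambda k * gap k is finite ([gap_summable]).

    Residuals.  The gap controls how far d and Q v are from being multiples of
    v; if both were, monotonicity would bound |v|^2 by the gap.  As
    gamma k |U k| stays away from 2 beta, this yields |v|^4 <= C gap
    ([residual_quartic]), so the sum of lambda k |v k|^4 is finite while the sum
    of the lambda k diverges.  It remains to exclude oscillation.  Residuals
    taken in two of the metrics at the same point are comparable
    ([residual_compare]), so v k may be replaced by the residual phi k of the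
    fixed map T 0, which is Lipschitz; since x moves by lambda k |v k| in one
    step, phi k grows at most by a factor 1 + O(lambda k), both up to summable
    errors.
    Then phi^4 converges, necessarily to 0 ([slow_growth_cvg0]).

    Limits.  Vanishing residuals force B (x k) to converge strongly to B x*
    ([forward_cvg]), and graph closedness of A puts every weak limit point in
    the set of solutions ([weak_limit_zer]).  Weak limit points are taken along
    ultrafilters, where they exist by the Riesz representation theorem
    ([ultra_weak_lim]); the convergence of the distances and of the Q k z shows
    that there is only one ([weak_limits_eq]), which gives weak convergence. *)

(** * Inner products *)

Section InnerProduct.
Variables (R : realType) (H : hilbertType R).
Local Notation "'[ x , y ]" := (@inner R H x y).
Implicit Types x y z : H.

Lemma innerC x y : '[x, y] = '[y, x].
Proof. by rewrite hermC /= expr0 mul1r. Qed.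

Lemma innerDl x y z : '[x + y, z] = '[x, z] + '[y, z].
Proof. by rewrite linearDl. Qed.

Lemma innerNl x y : '[- x, y] = - '[x, y].
Proof. by rewrite linearNl. Qed.

Lemma innerZl a x y : '[a *: x, y] = a * '[x, y].
Proof. by rewrite linearZl_LR. Qed.

Lemma innerDr x y z : '[z, x + y] = '[z, x] + '[z, y].
Proof. by rewrite innerC innerDl !(innerC z). Qed.

Lemma innerNr x y : '[x, - y] = - '[x, y].
Proof. by rewrite innerC innerNl innerC. Qed.

Lemma innerZr a x y : '[x, a *: y] = a * '[x, y].
Proof. by rewrite innerC innerZl innerC. Qed.

Definition innerE :=
  (innerDl, innerDr, innerNl, innerNr, innerZl, innerZr).

Lemma inner0l x : '[0, x] = 0.
Proof. by rewrite -(scale0r 0) innerZl mul0r. Qed.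

Lemma inner_ge0 x : 0 <= '[x, x].
Proof.
by have [->|/neq0_dnorm_gt0/ltW//] := eqVneq x 0; rewrite inner0l.
Qed.

Lemma inner_norm2 x : '[x, x] = `|x| ^+ 2.
Proof. by rewrite normr_inner sqr_sqrtr // inner_ge0. Qed.

(** Testing against every vector turns identities between vectors into
    identities between scalars, which are in the reach of ring. *)
Lemma inner_inj x y : (forall w, '[x, w] = '[y, w]) -> x = y.
Proof.
move=> xy; apply/eqP; rewrite -subr_eq0 -normr_eq0 -sqrf_eq0 -inner_norm2.
by rewrite innerDl innerNl xy subrr.
Qed.

(** The discriminant of the nonnegative quadratic
    t |-> <T (x + t y), x + t y> is nonpositive.  Stated for a semidefinite
    operator because the variable metrics are needed as often as the norm. *)
Lemma semidefinite_CauchySchwarz (T : {linear H -> H}) x y :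
  self_adjoint T -> (forall z, 0 <= '[T z, z]) ->
  '[T x, y] ^+ 2 <= '[T x, x] * '[T y, y].
Proof.
move=> sT T0.
have Tyx : '[T y, x] = '[T x, y] by rewrite sT innerC.
have q t : 0 <= '[T x, x] + 2 * t * '[T x, y] + t ^+ 2 * '[T y, y].
  have := T0 (x + t *: y).
  by rewrite (linearD T) (linearZZ T) !innerE Tyx; congr (0 <= _); ring.
have [Ty0|Ty_neq0] := eqVneq '[T y, y] 0.
  have [->|Txy] := eqVneq '[T x, y] 0; first by rewrite Ty0 mulr0 expr0n.
  have := q (- ('[T x, x] + 1) / (2 * '[T x, y])).
  rewrite Ty0 mulr0 addr0.
  rewrite (_ : 2 * _ * _ = - ('[T x, x] + 1)); last by field.
  by move=> h; exfalso; lra.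
have Ty_gt0 : 0 < '[T y, y] by rewrite lt_def Ty_neq0 T0.
have := mulr_ge0 (T0 y) (q (- '[T x, y] / '[T y, y])).
rewrite (_ : _ * _ = '[T x, x] * '[T y, y] - '[T x, y] ^+ 2); last by field.
by rewrite subr_ge0.
Qed.

Lemma CauchySchwarz x y : `|'[x, y]| <= `|x| * `|y|.
Proof.
rewrite -(@ler_pXn2r _ 2) ?nnegrE ?mulr_ge0 //.
rewrite real_normK ?num_real // exprMn -!inner_norm2.
exact: (@semidefinite_CauchySchwarz (idfun : {linear H -> H}) x y _ inner_ge0).
Qed.

Lemma inner_le_norm x y : '[x, y] <= `|x| * `|y|.
Proof. exact: le_trans (ler_norm _) (CauchySchwarz x y). Qed.

Lemma inner_ge_norm x y : - (`|x| * `|y|) <= '[x, y].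
Proof. by have := CauchySchwarz x y; rewrite ler_norml => /andP[]. Qed.

(** A positive operator K dominated by c I satisfies K^2 <= c K: bound
    <Kx, Kx> by Cauchy-Schwarz for the form of K, then cancel. *)
Lemma norm2_le_quadratic (K : {linear H -> H}) (c : R) x :
  self_adjoint K -> (forall z, 0 <= '[K z, z] <= c * `|z| ^+ 2) ->
  `|K x| ^+ 2 <= c * '[K x, x].
Proof.
move=> sK K0c.
have K0 z : 0 <= '[K z, z] by have /andP[] := K0c z.
have [Kx0|Kx_neq0] := eqVneq (K x) 0.
  by rewrite Kx0 normr0 inner0l expr0n mulr0.
have Kx_gt0 : 0 < `|K x| ^+ 2 by rewrite exprn_gt0 // normr_gt0.
rewrite -(ler_pM2r Kx_gt0) -expr2.
have := semidefinite_CauchySchwarz x (K x) sK K0.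
rewrite {1}inner_norm2 => /le_trans; apply.
rewrite [leRHS]mulrAC mulrC ler_wpM2r //.
by have /andP[] := K0c (K x).
Qed.

Lemma wnorm_ge0 (T : {linear H -> H}) x : 0 <= wnorm T x.
Proof. exact: sqrtr_ge0. Qed.

Section SemidefiniteNorm.
Variable T : {linear H -> H}.
Hypotheses (sT : self_adjoint T) (T0 : forall z, 0 <= '[T z, z]).

Lemma wnorm2 x : wnorm T x ^+ 2 = '[T x, x].
Proof. by rewrite sqr_sqrtr. Qed.

Lemma wnorm_CauchySchwarz x y : '[T x, y] <= wnorm T x * wnorm T y.
Proof.
apply: le_trans (ler_norm _) _.
rewrite -(@ler_pXn2r _ 2) ?nnegrE ?mulr_ge0 ?wnorm_ge0 //.
by rewrite real_normK ?num_real // exprMn !wnorm2 semidefinite_CauchySchwarz.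
Qed.

Lemma wnormD x y : wnorm T (x + y) <= wnorm T x + wnorm T y.
Proof.
rewrite -(@ler_pXn2r _ 2) ?nnegrE ?addr_ge0 ?wnorm_ge0 //.
have xy := wnorm_CauchySchwarz x y.
rewrite sqrrD !wnorm2 (linearD T) !innerE (_ : '[T y, x] = '[T x, y]); last first.
  by rewrite sT innerC.
by lra.
Qed.

End SemidefiniteNorm.

End InnerProduct.

(** * Minimisation of strongly convex functions *)

Section Minimisation.
Variable R : realType.

(** The direct method.  A strongly convex function is given by its epigraph S,
    so that it may be a supremum with no closed formula; d z z' is the gain of
    strong convexity at the midpoint.  Along a minimising sequence the gain is
    squeezed to zero, so the sequence is d-Cauchy. *)
Lemma exists_minimiser (Z : Type) (S : Z -> R -> Prop) (d : Z -> Z -> R)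
    (m : R) :
  (exists z r, S z r) ->
  (forall z r, S z r -> m <= r) ->
  (forall z r z' r', S z r -> S z' r' ->
     exists w, S w ((r + r') / 2 - d z z')) ->
  (forall (z : nat -> Z) (r : nat -> R) (l : R), (forall n, S (z n) (r n)) ->
     (forall e, 0 < e -> \forall N \near \oo, forall i j,
        (N <= i)%N -> (N <= j)%N -> d (z i) (z j) <= e) ->
     r @ \oo --> l -> exists w, S w l) ->
  exists w l, S w l /\ forall z r, S z r -> l <= r.
Proof.
move=> [z0 [r0 Szr0]] S_ge S_mid S_lim.
pose I := [set r | exists z, S z r].
have I_inf : has_inf I.
  by split; [exists r0, z0|exists m => r [z /S_ge]].
have l_le z r : S z r -> inf I <= r.
  by move=> Szr; apply: ge_inf; [exact: I_inf.2|exists z].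
have near_inf n : exists zr : Z * R,
    S zr.1 zr.2 /\ zr.2 < inf I + n.+1%:R^-1.
  have n0 : 0 < n.+1%:R^-1 :> R by rewrite invr_gt0.
  by have [r [z Szr] rlt] := inf_adherent n0 I_inf; exists (z, r).
pose f n := sval (cid (near_inf n)).
have fP n : S (f n).1 (f n).2 /\ (f n).2 < inf I + n.+1%:R^-1.
  exact: (svalP (cid (near_inf n))).
have d_le i j : d (f i).1 (f j).1 <= ((f i).2 + (f j).2) / 2 - inf I.
  have [w] := S_mid _ _ _ _ (fP i).1 (fP j).1.
  by move/l_le; lra.
have fl : (f n).2 @[n --> \oo] --> inf I.
  apply: (@squeeze_cvgr _ _ _ _ (fun=> inf I) (fun n => inf I + harmonic n)).
  - near=> n; rewrite (l_le _ _ (fP n).1) /=.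
    exact: ltW (fP n).2.
  - exact: cvg_cst.
  - rewrite -[X in _ --> X]addr0; apply: cvgD; first exact: cvg_cst.
    exact: cvg_harmonic.
have [w Sw] : exists w, S w (inf I).
  apply: (S_lim (fun n => (f n).1) (fun n => (f n).2)) => //.
    by move=> n; have [] := fP n.
  move=> e e0; move/cvgrPdist_le: (fl) => /(_ e e0) [N _ HN].
  exists N => // N' /= NN' i j Ni Nj.
  have := d_le i j.
  have := HN i (leq_trans NN' Ni); have := HN j (leq_trans NN' Nj).
  by rewrite !ler_distl => /andP[h1 _] /andP[h2 _] h3; lra.
by exists w, (inf I).
Unshelve. all: by end_near. Qed.

(** Divide by t and let t tend to 0. *)
Lemma ge0_slope (a b : R) :
  (forall t, 0 < t <= 1 -> 0 <= t * a + t ^+ 2 * b) -> 0 <= a.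
Proof.
move=> h; rewrite leNgt; apply/negP => a_lt0.
have b0 : 0 <= `|b| by [].
pose t := - a / (- a + `|b| + 1).
have t01 : 0 < t <= 1.
  by rewrite divr_gt0 ?ler_pdivrMr ?mul1r; lra.
have := h t t01; have -> : t * a + t ^+ 2 * b = t * (a + t * b) by ring.
rewrite pmulr_rge0; last by case/andP: t01.
have : t * b <= t * `|b| by rewrite ler_wpM2l ?ler_norm //; case/andP: t01; lra.
have : t * (- a + `|b| + 1) = - a by rewrite /t mulfVK //; lra.
by case/andP: t01; nra.
Qed.

End Minimisation.

Lemma cauchy_cvgn (R : realType) (V : completeNormedModType R) (z : nat -> V) :
  (forall e, 0 < e -> \forall N \near \oo, forall i j,
     (N <= i)%N -> (N <= j)%N -> `|z i - z j| <= e) -> cvgn z.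
Proof.
move=> h; apply/cauchy_cvgP/cauchyP => e e0.
have [N _ HN] := h (e / 2) ltac:(by rewrite divr_gt0).
exists (z N); exists N => // n /= Nn.
rewrite -ball_normE /=; apply: le_lt_trans (HN N _ _ _ _ Nn) _ => //=.
by lra.
Qed.

(** * Positive definite operators and their inverses *)

Lemma cauchy_sqr_cvgn (R : realType) (V : completeNormedModType R)
    (z : nat -> V) (c : R) : 0 < c ->
  (forall e, 0 < e -> \forall N \near \oo, forall i j,
     (N <= i)%N -> (N <= j)%N -> c * `|z i - z j| ^+ 2 <= e) -> cvgn z.
Proof.
move=> c0 h; apply: cauchy_cvgn => e e0.
have [|N _ HN] := h (c * e ^+ 2); first by rewrite mulr_gt0 ?exprn_gt0.
exists N => // n /= Nn i j ni nj.
have := HN n Nn i j ni nj.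
by rewrite ler_pM2l // ler_pXn2r // nnegrE // ltW.
Qed.

Lemma lipschitz_cvg (R : realType) (V W : normedModType R) (T : Type)
    (F : set_system T) (FF : Filter F) (f : V -> W) (C : R) (g : T -> V)
    (x : V) :
  (forall y, `|f x - f y| <= C * `|x - y|) -> g t @[t --> F] --> x ->
  f (g t) @[t --> F] --> f x.
Proof.
move=> fC /cvgrPdist_le gx; apply/cvgrPdist_le => e e0.
have C0 : 0 < `|C| + 1 by rewrite ltr_wpDl.
have eC : 0 < e / (`|C| + 1) by rewrite divr_gt0.
apply: filterS (gx _ eC) => t; rewrite ler_pdivlMr // => h.
apply: le_trans (fC _) _; apply: le_trans h; rewrite mulrC ler_wpM2l //.
by have := ler_norm C; lra.
Qed.

Section Operators.
Variables (R : realType) (H : hilbertType R).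
Local Notation "'[ x , y ]" := (@inner R H x y).
Implicit Types (x y z : H) (U : {linear H -> H}) (alpha : R).

Lemma cvg_inner (T : Type) (F : set_system T) (FF : Filter F)
    (f g : T -> H) x y :
  f t @[t --> F] --> x -> g t @[t --> F] --> y ->
  '[f t, g t] @[t --> F] --> '[x, y].
Proof.
move=> fx gy.
have h : `|x - f t| * (`|y| + `|y - g t|) + `|x| * `|y - g t|
    @[t --> F] --> (0 : R).
  have f0 : `|x - f t| @[t --> F] --> (0 : R).
    rewrite -[X in _ --> X](normr0 H) -(subrr x).
    by apply: cvg_norm; apply: cvgB => //; exact: cvg_cst.
  have g0 : `|y - g t| @[t --> F] --> (0 : R).
    rewrite -[X in _ --> X](normr0 H) -(subrr y).
    by apply: cvg_norm; apply: cvgB => //; exact: cvg_cst.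
  have -> : 0 = 0 * (`|y| + 0) + `|x| * 0 :> R by rewrite mul0r mulr0 addr0.
  apply: cvgD; apply: cvgM => //; last exact: cvg_cst.
  by apply: cvgD => //; exact: cvg_cst.
apply/cvgrPdist_le => e e0.
move/cvgrPdist_le: h => /(_ e e0); apply: filterS => t.
rewrite sub0r normrN => /(le_trans (ler_norm _)); apply: le_trans.
have -> : '[x, y] - '[f t, g t] = '[x - f t, g t] + '[x, y - g t].
  by rewrite !innerE; ring.
apply: le_trans (ler_normD _ _) _; apply: lerD; last exact: CauchySchwarz.
apply: le_trans (CauchySchwarz _ _) _; rewrite ler_wpM2l //.
by rewrite -[g t](subKr y) (le_trans (ler_normB _ _)) // subKr.
Qed.

Lemma Pclass_ge alpha U x : Pclass alpha U -> alpha * `|x| ^+ 2 <= '[U x, x].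
Proof.
by case=> _ _ /(_ x); rewrite /= innerZl inner_norm2.
Qed.

Lemma Pclass_ge0 alpha U x : 0 < alpha -> Pclass alpha U -> 0 <= '[U x, x].
Proof.
move=> /ltW alpha0 /(Pclass_ge x); apply: le_trans.
by rewrite mulr_ge0 ?exprn_ge0.
Qed.

Section BoundedOperator.
Variable U : {linear H -> H}.
Hypothesis U_bounded : bounded_fun_norm U.

Let opnorm_set := [set `|U x| | x in [set x : H | `|x| <= 1]].

Let opnorm_has_sup : has_sup opnorm_set.
Proof.
split; first by exists `|U 0|, 0 => //=; rewrite normr0.
by have [M UM] := U_bounded 1; exists M => _ [x /UM h <-].
Qed.

Lemma norm_le_opnorm x : `|U x| <= opnorm U * `|x|.
Proof.
have [->|x0] := eqVneq x 0; first by rewrite linear0 !normr0 mulr0.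
have nx0 : 0 < `|x| by rewrite normr_gt0.
rewrite -ler_pdivrMr // mulrC.
apply: (sup_upper_bound opnorm_has_sup); exists (`|x|^-1 *: x) => /=.
  by rewrite normrZ normfV normr_id mulVf // gt_eqF.
by rewrite linearZ normrZ normfV normr_id.
Qed.

Lemma opnorm_ge0 : 0 <= opnorm U.
Proof.
apply: le_trans (normr_ge0 (U 0)) _.
by apply: (sup_upper_bound opnorm_has_sup); exists 0 => //=; rewrite normr0.
Qed.

Lemma quadratic_le_opnorm x : '[U x, x] <= opnorm U * `|x| ^+ 2.
Proof.
apply: le_trans (inner_le_norm _ _) _.
by rewrite expr2 mulrA ler_wpM2r // norm_le_opnorm.
Qed.

Lemma bounded_linear_cvg (T : Type) (F : set_system T) (FF : Filter F)
    (f : T -> H) x :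
  f t @[t --> F] --> x -> U (f t) @[t --> F] --> U x.
Proof.
apply: (@lipschitz_cvg R H H T F FF U (opnorm U)) => y.
by rewrite -linearB norm_le_opnorm.
Qed.

End BoundedOperator.

(** Lax-Milgram for a symmetric form, by minimising <Uz, z>/2 - l z.  The case
    U = id is the Riesz representation theorem. *)
Lemma lax_milgram alpha U (l : H -> R) (M : R) :
  0 < alpha -> Pclass alpha U ->
  (forall a x y, l (a *: x + y) = a * l x + l y) ->
  (forall x, `|l x| <= M * `|x|) ->
  exists z, forall y, '[U z, y] = l y.
Proof.
move=> alpha0 PU l_lin l_bd; have [Ubd Usa _] := PU.
have Usym x y : '[U x, y] = '[U y, x] by rewrite Usa innerC.
have l0 : l 0 = 0.
  by apply/eqP; rewrite -normr_le0; have := l_bd 0; rewrite normr0 mulr0.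
have lD x y : l (x + y) = l x + l y by rewrite -{1}[x]scale1r l_lin mul1r.
have lZ a x : l (a *: x) = a * l x by rewrite -[_ *: _]addr0 l_lin l0 addr0.
pose phi z := '[U z, z] / 2 - l z.
have phi_cvg (z : nat -> H) w : z n @[n --> \oo] --> w ->
    phi (z n) @[n --> \oo] --> phi w.
  move=> zw; apply: cvgB; last first.
    apply: (@lipschitz_cvg R H R^o nat \oo _ l M) zw => y.
    by have := l_bd (w - y); rewrite lD -scaleN1r lZ mulN1r.
  apply: cvgM; last exact: cvg_cst.
  by apply: cvg_inner => //; exact: bounded_linear_cvg.
have [z [r [phizr z_min]]] : exists z r,
    phi z <= r /\ forall w s, phi w <= s -> r <= s.
  apply: (@exists_minimiser _ _ (fun z r => phi z <= r)
    (fun z w => alpha / 8 * `|z - w| ^+ 2) (- (M ^+ 2 / (2 * alpha)))).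
  - by exists 0, (phi 0).
  - move=> z r; apply: le_trans.
    have := Pclass_ge z PU; have := le_trans (ler_norm _) (l_bd z).
    have : 0 <= (alpha * `|z| - M) ^+ 2 / (2 * alpha).
      by rewrite divr_ge0 ?sqr_ge0 //; lra.
    have -> : (alpha * `|z| - M) ^+ 2 / (2 * alpha) =
        alpha * `|z| ^+ 2 / 2 - M * `|z| + M ^+ 2 / (2 * alpha).
      by field; rewrite gt_eqF.
    by rewrite /phi; lra.
  - move=> z r w s phiz phiw; exists (2^-1 *: (z + w)).
    have := Pclass_ge (z - w) PU.
    move: phiz phiw; rewrite /phi lZ lD linearZZ (linearB U) (linearD U) !innerE.
    by rewrite (Usym w z); lra.
  - move=> z r l' phizr z_cauchy rl.
    have a8 : 0 < alpha / 8 by lra.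
    have /cvg_ex[/= w zw] := cauchy_sqr_cvgn a8 z_cauchy.
    exists w; apply: ler_cvg_to (phi_cvg _ _ zw) rl _.
    by apply: nearW => n; exact: phizr.
have slope h : 0 <= '[U z, h] - l h.
  apply: (@ge0_slope _ _ ('[U h, h] / 2)) => t _.
  have := le_trans phizr (z_min (z + t *: h) _ (lexx _)).
  rewrite /phi lD lZ (linearD U) (linearZZ U) !innerE (Usym h z).
  by lra.
exists z => y; apply/eqP; rewrite eq_le; have := slope y; have := slope (- y).
have lN x : l (- x) = - l x by rewrite -scaleN1r lZ mulN1r.
by rewrite lN innerNr; lra.
Qed.

Section Inverse.
Variables (alpha : R) (U : {linear H -> H}).
Hypotheses (alpha0 : 0 < alpha) (PU : Pclass alpha U).

Let Ubd : bounded_fun_norm U. Proof. by case: PU. Qed.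
Let Usa : self_adjoint U. Proof. by case: PU. Qed.

Lemma Pclass_inj : injective U.
Proof.
move=> x y Uxy; apply/eqP; rewrite -subr_eq0 -normr_le0.
have := Pclass_ge (x - y) PU.
rewrite (linearB U) Uxy subrr inner0l pmulr_rle0 // => h.
by rewrite -(@ler_pXn2r _ 2) ?nnegrE // expr0n.
Qed.

Lemma inv_opK x : U (inv_op U x) = x.
Proof.
have [|z Uz] := @lax_milgram alpha U (fun y => '[x, y]) `|x| alpha0 PU _
  (CauchySchwarz x).
  by move=> a y y'; rewrite !innerE.
suff Uzx : [set z | U z = x] z by exact: (xgetPex 0 (ex_intro _ z Uzx)).
apply/eqP; rewrite -subr_eq0 -normr_le0 -(@ler_pXn2r _ 2) ?nnegrE //.
by rewrite expr0n -inner_norm2 innerDl innerNl Uz subrr.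
Qed.

Lemma op_invK x : inv_op U (U x) = x.
Proof. by apply: Pclass_inj; rewrite inv_opK. Qed.

Lemma inv_op_linear : exists Q : {linear H -> H}, inv_op U = Q.
Proof.
have lin : linear (inv_op U).
  by move=> a x y; apply: Pclass_inj; rewrite linearP !inv_opK.
pose L := GRing.isLinear.Build R H H *:%R (inv_op U) lin.
pose Q : {linear H -> H} := HB.pack (inv_op U) L.
by exists Q.
Qed.

Variable Q : {linear H -> H}.
Hypothesis QE : inv_op U = Q.

Lemma UQ x : U (Q x) = x. Proof. by rewrite -QE inv_opK. Qed.
Lemma QU x : Q (U x) = x. Proof. by rewrite -QE op_invK. Qed.

Lemma inv_self_adjoint : self_adjoint Q.
Proof. by move=> x y; rewrite -{1}[y]UQ -Usa UQ. Qed.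

Lemma inv_quadratic x : '[Q x, x] = '[U (Q x), Q x].
Proof. by rewrite UQ innerC. Qed.

Lemma inv_quadratic_ge x : `|x| ^+ 2 <= opnorm U * '[Q x, x].
Proof.
rewrite inv_quadratic -{1}[x]UQ; apply: norm2_le_quadratic => // z.
by rewrite quadratic_le_opnorm // andbT (Pclass_ge0 _ alpha0 PU).
Qed.

Lemma inv_quadratic_ge0 x : 0 <= '[Q x, x].
Proof.
by rewrite inv_quadratic; exact: Pclass_ge0 alpha0 PU.
Qed.

Lemma norm_inv_le x : `|Q x| <= alpha^-1 * `|x|.
Proof.
rewrite mulrC ler_pdivlMr //.
have [->|Qx0] := eqVneq `|Q x| 0; first by rewrite mul0r.
have {}Qx0 : 0 < `|Q x| by rewrite lt_def Qx0 /=.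
rewrite -(ler_pM2l Qx0) mulrA mulrC -expr2; apply: le_trans (Pclass_ge _ PU) _.
by rewrite -inv_quadratic inner_le_norm.
Qed.

Lemma inv_quadratic_le x : '[Q x, x] <= alpha^-1 * `|x| ^+ 2.
Proof.
apply: le_trans (inner_le_norm _ _) _.
by rewrite expr2 mulrA ler_wpM2r // norm_inv_le.
Qed.

End Inverse.

End Operators.

(** * Maximal monotone operators: Minty's theorem *)

Section Minty.
Variables (R : realType) (H : hilbertType R).
Local Notation "'[ x , y ]" := (@inner R H x y).
Implicit Types (x y z u v : H) (A : H -> set H).

(** Otherwise adjoining (x, u) to the graph gives a larger monotone operator. *)
Lemma maximal_monotone_mem A x u : maximal_monotone A ->
  (forall y v, A y v -> 0 <= '[x - y, u - v]) -> A x u.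
Proof.
move=> [Am Amax] xu.
apply: (Amax (fun y v => A y v \/ (y = x /\ v = u))); last by right.
2: by move=> y v /=; left.
move=> y y' v v' [Ayv|[-> ->]] [Ayv'|[-> ->]].
- exact: Am.
- by rewrite -(opprB x) -(opprB u) innerNl innerNr opprK; exact: xu.
- exact: xu.
- by rewrite subrr inner0l.
Qed.

(** Strong-weak closedness of the graph: since p is bounded, w k may be replaced
    by its strong limit in the pairing with p k. *)
Lemma maximal_monotone_closed A (F : set_system nat) (FF : ProperFilter F)
    (p w : nat -> H) x u M :
  maximal_monotone A -> (forall k, A (p k) (w k)) -> (forall k, `|p k| <= M) ->
  (forall y, '[p k, y] @[k --> F] --> '[x, y]) -> w k @[k --> F] --> u ->
  A x u.
Proof.
move=> Amax Apw pM px wu; have Amon := Amax.1.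
apply: maximal_monotone_mem Amax _ => y v Ayv.
have M0 : 0 <= M by exact: le_trans (normr_ge0 _) (pM 0%N).
have h k : 0 <= '[p k, u - v] - '[y, u - v] + (M + `|y|) * `|u - w k|.
  have /le_trans := Amon _ _ _ _ (Apw k) Ayv; apply.
  have : '[p k - y, w k - u] <= (M + `|y|) * `|u - w k|.
    apply: le_trans (inner_le_norm _ _) _; rewrite (distrC u) ler_wpM2r //.
    by apply: le_trans (ler_normB _ _) _; rewrite lerD2r.
  by rewrite !innerE; lra.
have lim : '[p k, u - v] - '[y, u - v] + (M + `|y|) * `|u - w k| @[k --> F] -->
    '[x, u - v] - '[y, u - v] + (M + `|y|) * 0.
  apply: cvgD; first by apply: cvgB; [exact: px|exact: cvg_cst].
  apply: cvgM; first exact: cvg_cst.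
  rewrite -[X in _ --> X](normr0 H) -(subrr u).
  by apply: cvg_norm; apply: cvgB => //; exact: cvg_cst.
suff : 0 <= '[x, u - v] - '[y, u - v] + (M + `|y|) * 0.
  by rewrite mulr0 addr0 innerDl innerNl.
by apply: (ler_cvg_to (cvg_cst 0) lim); exact: nearW.
Qed.

(** Minty's theorem for P^-1 + A, at the point 0.  Minimise the sum of the
    Fitzpatrick function
      F(x, u) = sup { <x, v> + <y, u> - <y, v> | v in A y }
    and of (<P^-1 x, x> + <P u, u>)/2.  Maximality gives F(x, u) >= <x, u>, so
    the sum is nonnegative; the first variation at a minimiser (x, u) in the
    directions of the graph of A shows that (- P u, - P^-1 x) is monotonically
    related to A, hence lies in its graph, and then that x = - P u. *)
Lemma minty0 A (alpha : R) (P : {linear H -> H}) :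
  0 < alpha -> Pclass alpha P -> maximal_monotone A ->
  exists x u, A x u /\ x + P u = 0.
Proof.
move=> alpha0 PP Amax; have Amon := Amax.1; have [Pbd Psa _] := PP.
have [Q QE] := inv_op_linear alpha0 PP.
have Qsa := inv_self_adjoint alpha0 PP QE.
have Psym x y : '[P x, y] = '[P y, x] by rewrite Psa innerC.
have Qsym x y : '[Q x, y] = '[Q y, x] by rewrite Qsa innerC.
have PQ := UQ alpha0 PP QE.
have Qbd : bounded_fun_norm Q.
  move=> r; exists (alpha^-1 * r) => x xr.
  apply: le_trans (norm_inv_le alpha0 PP QE x) _.
  by rewrite ler_wpM2l // invr_ge0 ltW.
pose N := opnorm P + 1.
have N0 : 0 < N by rewrite ltr_wpDl // opnorm_ge0.
have Q_ge x : N^-1 * `|x| ^+ 2 <= '[Q x, x].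
  rewrite mulrC ler_pdivrMr // mulrC.
  apply: le_trans (inv_quadratic_ge alpha0 PP QE x) _.
  by rewrite ler_wpM2r ?(inv_quadratic_ge0 alpha0 PP QE) // lerDl.
pose q (z : H * H) := ('[Q z.1, z.1] + '[P z.2, z.2]) / 2.
pose f (z w : H * H) := '[z.1, w.2] + '[w.1, z.2] - '[w.1, w.2].
pose S (z : H * H) (c : R) := forall y v, A y v -> f z (y, v) + q z <= c.
(* The witness is z itself when z is in the graph of A. *)
have f_ge (z : H * H) : exists y v, A y v /\ '[z.1, z.2] <= f z (y, v).
  apply: contrapT => h; have Az : A z.1 z.2.
    apply: maximal_monotone_mem Amax _ => y v Ayv.
    rewrite leNgt; apply/negP => neg; apply: h; exists y, v; split => //.
    by move: neg; rewrite /f /= !innerE; lra.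
  by apply: h; exists z.1, z.2; split => //; rewrite /f /=; lra.
have q_ge (z : H * H) : 0 <= '[z.1, z.2] + q z.
  have := Pclass_ge0 (Q z.1 + z.2) alpha0 PP.
  rewrite /q (linearD P) PQ !innerE (Psym z.2) PQ (innerC z.1 (Q _)).
  by lra.
have [z [c [Szc z_min]]] : exists (z : H * H) c,
    S z c /\ forall w s, S w s -> c <= s.
  pose d (z w : H * H) := q (z.1 - w.1, z.2 - w.2) / 4.
  apply: (@exists_minimiser R (H * H)%type S d 0).
  - have [y [v [Ayv _]]] := f_ge (0, 0).
    exists (y, v), ('[y, v] + q (y, v)) => y' v' Ayv'.
    by have := Amon _ _ _ _ Ayv Ayv'; rewrite /f /= !innerE; lra.
  - move=> w s Sw; have [y [v [Ayv fw]]] := f_ge w.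
    by have := Sw _ _ Ayv; have := q_ge w; lra.
  - move=> z r w s Sz Sw; exists (2^-1 *: (z.1 + w.1), 2^-1 *: (z.2 + w.2)).
    move=> y v Ayv; move: (Sz _ _ Ayv) (Sw _ _ Ayv); rewrite /d /f /q /=.
    rewrite !(linearZZ P, linearZZ Q, linearD P, linearD Q, linearN P, linearN Q).
    by rewrite !innerE (Qsym w.1 z.1) (Psym w.2 z.2); lra.
  - move=> z r l Sz z_cauchy rl.
    have dE i j : d (z i) (z j) =
        '[Q ((z i).1 - (z j).1), (z i).1 - (z j).1] / 8
        + '[P ((z i).2 - (z j).2), (z i).2 - (z j).2] / 8.
      by rewrite /d /q /=; lra.
    have N8 : 0 < N^-1 / 8 by rewrite divr_gt0 ?invr_gt0.
    have a8 : 0 < alpha / 8 by rewrite divr_gt0.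
    have /cvg_ex[/= x zx] : cvgn (fun n => (z n).1).
      apply: (cauchy_sqr_cvgn N8) => e /z_cauchy; apply: filterS => n h i j ni nj.
      apply: le_trans (h i j ni nj); rewrite dE.
      have := Q_ge ((z i).1 - (z j).1).
      have := Pclass_ge0 ((z i).2 - (z j).2) alpha0 PP.
      by lra.
    have /cvg_ex[/= u zu] : cvgn (fun n => (z n).2).
      apply: (cauchy_sqr_cvgn a8) => e /z_cauchy; apply: filterS => n h i j ni nj.
      apply: le_trans (h i j ni nj); rewrite dE.
      have := Pclass_ge ((z i).2 - (z j).2) PP.
      have := inv_quadratic_ge0 alpha0 PP QE ((z i).1 - (z j).1).
      by lra.
    exists (x, u) => y v Ayv.
    apply: (@ler_cvg_to _ _ _ _ (fun n => f (z n) (y, v) + q (z n)) r) rl _.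
      apply: cvgD.
        apply: cvgB; last exact: cvg_cst.
        by apply: cvgD; apply: cvg_inner => //; exact: cvg_cst.
      apply: cvgM; last exact: cvg_cst.
      by apply: cvgD; apply: cvg_inner => //; exact: bounded_linear_cvg.
    by apply: nearW => n; exact: Sz.
pose x := z.1; pose u := z.2.
have slope y v : A y v ->
    c <= '[y, v] + q z + '[Q x, y - x] + '[P u, v - u].
  move=> Ayv; rewrite -subr_ge0.
  apply: (@ge0_slope _ _ (q (y - x, v - u))) => t t01.
  pose zt := (x + t *: (y - x), u + t *: (v - u)).
  have Szt : S zt ((1 - t) * (c - q z) + t * '[y, v] + q zt).
    move=> y' v' Ayv'; rewrite lerD2r.
    have zle : (1 - t) * f z (y', v') <= (1 - t) * (c - q z).
      by rewrite ler_wpM2l; [|lra|]; have := Szc _ _ Ayv'; lra.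
    have yle : 0 <= t * '[y - y', v - v'].
      by rewrite mulr_ge0; [|lra|exact: Amon].
    move: zle yle; rewrite /f /zt /= -/x -/u !innerE; lra.
  have := z_min _ _ Szt; rewrite /q /zt /= -/x -/u.
  rewrite !(linearZZ P, linearZZ Q, linearD P, linearD Q, linearN P, linearN Q).
  rewrite !innerE (Qsym y x) (Psym v u); lra.
have c_ge : '[x, u] + q z <= c.
  have [y [v [Ayv fz]]] := f_ge z.
  by have := Szc _ _ Ayv; rewrite /x /u; lra.
have quad : '[Q x, x] + '[P u, u] + 2 * '[x, u] = '[P (Q x + u), Q x + u].
  rewrite (linearD P) PQ !innerE (Psym u) PQ (innerC x (Q _)); lra.
have key y v : A y v -> '[P (Q x + u), Q x + u] <= '[- P u - y, - Q x - v].
  move/slope; move: c_ge; rewrite -quad /q -/x -/u !innerE.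
  rewrite (innerC y (Q x)) (innerC (P u) (Q x)) -(Psa (Q x)) PQ.
  by lra.
have AxA : A (- P u) (- Q x).
  apply: maximal_monotone_mem Amax _ => y v /key; apply: le_trans.
  exact: Pclass_ge0 alpha0 PP.
have Qxu : Q x + u = 0.
  apply/eqP; rewrite -normr_le0 -(@ler_pXn2r _ 2) ?nnegrE // expr0n /=.
  rewrite -(pmulr_rle0 _ alpha0); apply: le_trans (Pclass_ge _ PP) _.
  by apply: le_trans (key _ _ AxA) _; rewrite !subrr inner0l.
have uE : u = - Q x by apply/eqP; rewrite -addr_eq0 addrC Qxu.
exists (- P u), (- Q x); split => //.
by rewrite -uE addNr.
Qed.

Lemma minty A (alpha : R) (P : {linear H -> H}) z :
  0 < alpha -> Pclass alpha P -> maximal_monotone A ->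
  exists x u, A x u /\ x + P u = z.
Proof.
move=> alpha0 PP [Am Amax].
have A'max : maximal_monotone (fun x => A (x + z)).
  split=> [x y u v Axu Ayv|A' A'm AA' x u A'xu].
    by have := Am _ _ _ _ Axu Ayv; rewrite opprD addrACA subrr addr0.
  apply: (Amax (fun x => A' (x - z))); last by rewrite addrK.
    move=> a b v w Aav Abw; have := A'm _ _ _ _ Aav Abw.
    by rewrite opprB addrA addrNK.
  by move=> y v /= Ayv; apply: AA'; rewrite subrK.
have [x [u [Axu xPu]]] := minty0 alpha0 PP A'max.
by exists (x + z), u; split => //; rewrite addrAC xPu add0r.
Qed.

End Minty.

(** * Real sequences and summability *)

Section RealSequences.
Variable R : realType.
Implicit Types (u v s eta eps lambda : nat -> R).

Lemma summableD u v :
  cvgn (series u) -> cvgn (series v) -> cvgn (series (fun k => u k + v k)).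
Proof. by move=> cu cv; exact: is_cvg_seriesD cu cv. Qed.

Lemma summableZ (c : R) u :
  cvgn (series u) -> cvgn (series (fun k => c * u k)).
Proof. by move=> cu; exact: (is_cvg_seriesZ (k := c) cu). Qed.

Lemma summable_le u v : (forall k, 0 <= u k <= v k) ->
  cvgn (series v) -> cvgn (series u).
Proof.
move=> uv; apply: series_le_cvg => k; have /andP[u0 uvk] := uv k => //.
exact: le_trans uvk.
Qed.

Lemma summable_bounded u : (forall k, 0 <= u k) ->
  (exists M, forall n, series u n <= M) -> cvgn (series u).
Proof.
move=> u0 [M uM]; apply: nondecreasing_is_cvgn.
  by apply: nondecreasing_series => *; exact: u0.
by exists M => _ [n _ <-].
Qed.

Lemma cvgn_ubound u : cvgn u -> exists2 M, 0 <= M & forall n, u n <= M.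
Proof.
move=> /cvg_seq_bounded/bounded_fun_has_ubound[M uM].
exists `|M| => // n; apply: le_trans (ler_norm M).
by apply: uM; exists n.
Qed.

(** The product of the 1 + eta i is dominated by the exponential of the sum of
    the eta i, so s is bounded; then s k.+1 <= s k + delta k with delta
    summable, and s minus the partial sums of delta is nonincreasing. *)
Lemma quasi_nonincreasing_cvgn s eta eps :
  (forall k, 0 <= s k) -> (forall k, 0 <= eta k) -> (forall k, 0 <= eps k) ->
  cvgn (series eta) -> cvgn (series eps) ->
  (forall k, s k.+1 <= (1 + eta k) * (s k + eps k)) -> cvgn s.
Proof.
move=> s0 eta0 eps0 ceta ceps s_step.
have series_ge0 u n : (forall k, 0 <= u k) -> 0 <= series u n.
  by move=> u0; rewrite sumr_ge0.
have s_le n : s n <= expR (series eta n) * (s 0%N + series eps n).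
  elim: n => [|n IHn].
    by rewrite /series /= !big_geq // expR0 mul1r addr0.
  rewrite !seriesSr addrA expRD.
  have e1 : 1 <= expR (series eta n) by rewrite -expR0 ler_expR series_ge0.
  apply: le_trans (s_step n) _.
  apply: (@le_trans _ _ (expR (eta n) * (s n + eps n))).
    by rewrite ler_wpM2r ?expR_ge1Dx // addr_ge0.
  rewrite [leRHS](_ : _ = expR (eta n) *
    (expR (series eta n) * (s 0%N + series eps n + eps n))); last by ring.
  rewrite ler_wpM2l ?expR_ge0 // mulrDr.
  by rewrite lerD // ler_peMl.
have [M1 M10 etaM] := cvgn_ubound ceta.
have [M2 M20 epsM] := cvgn_ubound ceps.
pose M := expR M1 * (s 0%N + M2).
have sM n : s n <= M.
  apply: le_trans (s_le n) _; apply: ler_pM; rewrite ?expR_ge0 ?ler_expR //.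
    by rewrite addr_ge0 ?series_ge0.
  by rewrite lerD2l.
pose delta k := M * eta k + (1 + M1) * eps k.
have delta0 k : 0 <= delta k.
  by rewrite addr_ge0 ?mulr_ge0 ?addr_ge0 ?expR_ge0.
have cdelta : cvgn (series delta) by apply: summableD; exact: summableZ.
have etaM1 k : eta k <= M1.
  by apply: le_trans (etaM k.+1); rewrite seriesSr lerDr series_ge0.
have [D D0 deltaD] := cvgn_ubound cdelta.
pose t n := s n - series delta n.
have ct : cvgn t.
  apply: nonincreasing_is_cvgn.
    apply/nonincreasing_seqP => n; rewrite /t seriesSr opprD addrA.
    rewrite addrAC lerD2r lerBlDr; apply: le_trans (s_step n) _.
    rewrite /delta.
    have : eta n * s n <= M * eta n by rewrite mulrC ler_wpM2r.
    have : eta n * eps n <= M1 * eps n by rewrite ler_wpM2r.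
    by lra.
  exists (- D) => _ [n _ <-].
  by rewrite /t lerBrDr addrC; apply: le_trans (s0 n); rewrite subr_le0.
rewrite (_ : s = (fun n => t n + series delta n)).
  exact: is_cvgD.
by apply/funext => n; rewrite /t subrK.
Qed.

Lemma summable_decrease s u delta :
  (forall k, 0 <= s k) -> (forall k, 0 <= u k) ->
  cvgn (series delta) -> (forall k, s k.+1 <= s k - u k + delta k) ->
  cvgn (series u).
Proof.
move=> s0 u0 cdelta s_step; apply: summable_bounded => //.
have [D _ deltaD] := cvgn_ubound cdelta.
exists (s 0%N + D) => n.
have : series u n + s n <= s 0%N + series delta n.
  elim: n => [|n IHn]; first by rewrite /series /= !big_geq // add0r addr0.
  by rewrite !seriesSr; have := s_step n; lra.
by have := deltaD n; have := s0 n; lra.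
Qed.

Lemma cvg0_of_summable lambda s :
  (forall k, 0 <= lambda k) -> (forall k, 0 <= s k) ->
  series lambda @ \oo --> +oo -> cvgn (series (fun k => lambda k * s k)) ->
  cvgn s -> s @ \oo --> (0 : R).
Proof.
move=> lambda0 s0 lambda_oo cls /cvg_ex[/= l sl].
have l0 : 0 <= l by apply: (ler_cvg_to (cvg_cst 0) sl); exact: nearW.
suff -> : 0 = l by [].
apply/eqP; rewrite eq_le l0 leNgt; apply/negP => l_gt0.
have [M _ lsM] := cvgn_ubound cls.
have l2 : 0 < l / 2 by rewrite divr_gt0.
move/cvgrPdist_le: (sl) => /(_ _ l2) [N _ HN].
have key n : (N <= n)%N ->
    l / 2 * (series lambda n - series lambda N) <=
    series (fun k => lambda k * s k) n.
  elim: n => [|n IHn].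
    rewrite leqn0 => /eqP ->; rewrite subrr mulr0 /series /= big_geq //.
  rewrite leq_eqVlt => /predU1P[<-|]; last rewrite ltnS => Nn.
    by rewrite subrr mulr0 sumr_ge0 // => i _; exact: mulr_ge0.
  rewrite !seriesSr; have := IHn Nn.
  have : l / 2 * lambda n <= lambda n * s n.
    rewrite mulrC ler_wpM2l //; have := HN n Nn.
    by rewrite /= ler_distl => /andP[_]; lra.
  by lra.
move/cvgryPge: lambda_oo => /(_ (series lambda N + (M + 1) / (l / 2))) [N' _ HN'].
have := HN' (maxn N N') (leq_maxr _ _) => /= h.
have := le_trans (key _ (leq_maxl N N')) (lsM _).
rewrite leNgt => /negP; apply.
have : (M + 1) / (l / 2) <= series lambda (maxn N N') - series lambda N by lra.
rewrite ler_pdivrMr //; lra.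
Qed.

(** Applied twice below, to pass from phi to its fourth power. *)
Lemma sqr_growth (a b e l K M : R) :
  0 <= a -> 0 <= b -> a <= M -> b <= M -> 0 <= e -> 0 <= l <= 2 -> 0 <= K ->
  b <= (1 + K * l) * a + K * e ->
  b ^+ 2 <= (1 + (2 * K + 2 * K ^+ 2) * l) * a ^+ 2
            + (2 * K + 2 * K ^+ 2) * (M * e).
Proof.
move=> a0 b0 aM bM e0 /andP[l0 l2] K0 bstep.
have Kl0 : 0 <= K * l by exact: mulr_ge0.
have bb : b * b <= b * ((1 + K * l) * a + K * e) by rewrite ler_wpM2l.
have ba : b * ((1 + K * l) * a) <= ((1 + K * l) * a + K * e) * ((1 + K * l) * a).
  by rewrite ler_wpM2r // mulr_ge0 // addr_ge0.
have be : b * (K * e) <= M * (K * e) by rewrite ler_wpM2r // mulr_ge0.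
have Kl2 : K * l <= K * 2 by rewrite ler_wpM2l.
have ae : K * e * ((1 + K * l) * a) <= K * e * ((1 + K * 2) * M).
  rewrite ler_wpM2l ?mulr_ge0 //; apply: ler_pM => //; first by rewrite addr_ge0.
  by rewrite lerD2l.
have KKl : K ^+ 2 * l ^+ 2 * a ^+ 2 <= K ^+ 2 * (2 * l) * a ^+ 2.
  rewrite ler_wpM2r ?sqr_ge0 // ler_wpM2l ?sqr_ge0 // expr2 ler_wpM2r //.
by move: bb ba be ae KKl; lra.
Qed.

(** Up to summable errors phi grows by at most O(lambda k phi k) per step, hence
    phi ^ 4 by at most O(lambda k (phi k) ^ 4), which is summable: so phi
    converges, and the only limit compatible with a divergent sum of the
    lambda k is 0.  In the time scale of the partial sums of lambda, phi cannot
    grow back fast enough to escape from the integrability of phi ^ 4. *)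
Lemma slow_growth_cvg0 phi lambda eps (K M : R) :
  0 <= K -> (forall k, 0 <= phi k <= M) -> (forall k, 0 <= lambda k <= 2) ->
  (forall k, 0 <= eps k) -> cvgn (series eps) ->
  (forall k, phi k.+1 <= (1 + K * lambda k) * phi k + K * eps k) ->
  series lambda @ \oo --> +oo ->
  cvgn (series (fun k => lambda k * phi k ^+ 4)) -> phi @ \oo --> (0 : R).
Proof.
move=> K0 phiM lambda2 eps0 ceps phi_step lambda_oo cphi.
have phi0 k : 0 <= phi k by have /andP[] := phiM k.
have phile k : phi k <= M by have /andP[] := phiM k.
have M0 : 0 <= M by exact: le_trans (phi0 0%N) (phile 0%N).
pose K2 := 2 * K + 2 * K ^+ 2.
have K20 : 0 <= K2 by rewrite addr_ge0 ?mulr_ge0 ?sqr_ge0.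
have step2 k := sqr_growth (phi0 k) (phi0 k.+1) (phile k) (phile k.+1) (eps0 k)
  (lambda2 k) K0 (phi_step k).
have sq0 k : 0 <= phi k ^+ 2 by exact: sqr_ge0.
have sqM k : phi k ^+ 2 <= M ^+ 2 by rewrite ler_pXn2r ?nnegrE.
have Meps0 k : 0 <= M * eps k by exact: mulr_ge0.
pose K4 := 2 * K2 + 2 * K2 ^+ 2.
have K40 : 0 <= K4 by rewrite addr_ge0 ?mulr_ge0 ?sqr_ge0.
have step4 k := sqr_growth (sq0 k) (sq0 k.+1) (sqM k) (sqM k.+1) (Meps0 k)
  (lambda2 k) K20 (step2 k).
have c4 : cvgn (fun k => phi k ^+ 4).
  pose e4 k := K4 * (lambda k * phi k ^+ 4) + K4 * (M ^+ 2 * (M * eps k)).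
  apply: (@quasi_nonincreasing_cvgn _ (fun=> 0) e4) => //.
  - by move=> k; rewrite exprn_ge0.
  - move=> k; rewrite /e4 addr_ge0 // !mulr_ge0 ?exprn_ge0 //.
    by have /andP[] := lambda2 k.
  - rewrite /series /= (_ : (fun _ => _) = cst 0); first exact: is_cvg_cst.
    by apply/funext => n; rewrite big1.
  - by apply: summableD; [exact: summableZ cphi|do 3!apply: summableZ].
  - move=> k; rewrite addr0 mul1r /e4.
    by have := step4 k; rewrite -/K4 -!exprM; lra.
have phi40 : (fun k => phi k ^+ 4) @ \oo --> (0 : R).
  apply: (cvg0_of_summable _ _ lambda_oo) => //.
    by move=> k; have /andP[] := lambda2 k.
  by move=> k; rewrite exprn_ge0.
apply/cvgrPdist_lt => e e0; have e4 : 0 < e ^+ 4 by rewrite exprn_gt0.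
move/cvgrPdist_lt: phi40 => /(_ _ e4); apply: filterS => k.
rewrite !sub0r !normrN !ger0_norm ?exprn_ge0 //.
by rewrite ltr_pXn2r ?nnegrE // ltW.
Qed.

End RealSequences.

(** * Weak limits along ultrafilters *)

Lemma ultra_fmap (T U : Type) (f : T -> U) (F : set_system T) :
  UltraFilter F -> UltraFilter (f @ F).
Proof.
move=> FU; have FP : ProperFilter F by exact: ultra_proper.
split=> [|G GP FG]; first exact: fmap_proper_filter.
apply/seteqP; split=> // B GB /=.
have [//|FC] := in_ultra_setVsetC (f @^-1` B) FU.
have GC : G (~` B) by exact: FG.
by have [b [Bb]] := filter_ex (filterI GB GC).
Qed.

Section WeakLimits.
Variables (R : realType) (H : hilbertType R).
Local Notation "'[ x , y ]" := (@inner R H x y).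
Implicit Types (x : nat -> H) (p q y : H) (F : set_system nat).

Definition weak_lim F x p := forall y, '[x k, y] @[k --> F] --> '[p, y].

Lemma Pclass_id : Pclass 1 (idfun : {linear H -> H}).
Proof.
split=> [r|//|z]; first by exists r.
by rewrite /= scale1r.
Qed.

(** Ultrafilters replace the extraction of weakly convergent subsequences: the
    limit of <x k, y> exists by compactness of a segment, is linear and bounded
    in y, hence is represented by a vector. *)
Lemma ultra_weak_lim F x (M : R) : UltraFilter F ->
  (forall k, `|x k| <= M) -> exists p, weak_lim F x p.
Proof.
move=> FU xM; have FP : ProperFilter F by exact: ultra_proper.
have lim y : exists r : R, `|r| <= M * `|y| /\ '[x k, y] @[k --> F] --> r.
  have := @segment_compact R (- (M * `|y|)) (M * `|y|).
  rewrite compact_ultra => /(_ ('[x k, y] @[k --> F]) (ultra_fmap _ FU)).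
  case.
    apply: (@filterE _ F) => k; rewrite /= in_itv /= -ler_norml.
    by apply: le_trans (CauchySchwarz _ _) _; rewrite ler_wpM2r.
  by move=> r [/=]; rewrite in_itv /= -ler_norml; exists r.
pose l y := sval (cid (lim y)).
have lP y : `|l y| <= M * `|y| /\ '[x k, y] @[k --> F] --> l y.
  exact: svalP (cid (lim y)).
have l_lin a y z : l (a *: y + z) = a * l y + l z.
  apply: (cvg_unique _ (lP _).2) => /=; first exact: norm_hausdorff.
  under eq_cvg do rewrite innerDr innerZr.
  by apply: cvgD; [apply: cvgM; [exact: cvg_cst|exact: (lP _).2]|exact: (lP _).2].
have [p pl] := lax_milgram ltr01 Pclass_id l_lin (fun y => (lP y).1).
by exists p => y; rewrite [X in _ --> X]pl; exact: (lP y).2.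
Qed.

Lemma weak_cvg_ultra x (M : R) p : (forall k, `|x k| <= M) ->
  (forall F q, UltraFilter F -> \oo `<=` F -> weak_lim F x q -> q = p) ->
  weak_cvg x p.
Proof.
move=> xM uniq_lim y; apply/cvgrPdist_lt => e e0; apply: contrapT => not_near.
pose far := [set k | e <= `|'[p, y] - '[x k, y]|].
have far_proper : ProperFilter (within far \oo).
  apply: Build_ProperFilter_ex => B; rewrite /within /= => oo_B.
  apply: contrapT => B0; apply: not_near; apply: filterS oo_B => k kB.
  by rewrite ltNge; apply/negP => far_k; apply: B0; exists k; exact: kB.
have [F [FU far_F]] := ultraFilterLemma far_proper.
have oo_F : \oo `<=` F.
  by move=> B oo_B; apply: far_F; apply: filterS oo_B => k.
have FP : ProperFilter F by exact: ultra_proper.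
have [q xq] := ultra_weak_lim FU xM.
have := xq y; rewrite (uniq_lim _ _ FU oo_F xq) => /cvgrPdist_lt /(_ e e0) near_F.
have far_in : F far.
  by apply: far_F; rewrite /within; apply: (@filterE _ \oo) => k.
have [k [/= kfar knear]] := filter_ex (filterI far_in near_F).
by move: knear; rewrite ltNge kfar.
Qed.

End WeakLimits.

(** * One forward-backward step *)

Section ForwardBackward.
Variables (R : realType) (H : hilbertType R).
Local Notation "'[ x , y ]" := (@inner R H x y).
Variables (A : H -> set H) (B : H -> H) (beta : R).
Hypotheses (A_max : maximal_monotone A) (beta0 : 0 < beta)
  (B_coco : cocoercive beta B).
Implicit Types (x y z p d e f s v xs : H).

Let A_mono : monotone A := A_max.1.

Lemma cocoercive_lipschitz x y : `|B x - B y| <= beta^-1 * `|x - y|.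
Proof.
rewrite mulrC ler_pdivlMr // mulrC.
have [->|Bxy] := eqVneq `|B x - B y| 0; first by rewrite mulr0.
have {}Bxy : 0 < `|B x - B y| by rewrite lt_def Bxy /=.
rewrite -(ler_pM2r Bxy) -mulrA -expr2; apply: le_trans (B_coco x y) _.
exact: inner_le_norm.
Qed.

Lemma zerP xs : zer (add_op A B) xs <-> A xs (- B xs).
Proof.
split=> [[u Au uB]|Axs]; last by exists (- B xs) => //; rewrite addNr.
by rewrite -[- B xs]add0r -uB addrK.
Qed.

(** p is the image of x by the forward-backward operator of the metric L,
    which stands for the inverse of gamma U: in this form, without inverses on
    the side of A, images in different metrics can be compared. *)
Definition forward_backward (L : H -> H) x p := A p (L (x - p) - B x).

Lemma forward_backward_zer (L : {linear H -> H}) xs :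
  zer (add_op A B) xs -> forward_backward L xs xs.
Proof. by rewrite /forward_backward subrr linear0 sub0r => /zerP. Qed.

Section Comparison.
Variables c C : R.
Hypotheses (c0 : 0 < c).

Definition metric_bounds (L : {linear H -> H}) :=
  forall z, c * `|z| ^+ 2 <= '[L z, z] /\ `|L z| <= C * `|z|.

(** With v1 and v2 the two residuals, monotonicity of A between the two images
    gives <L2 v2, v2> <= <L1 v1, v2> + <L2 v2, v1>. *)
Lemma residual_compare (L1 L2 : {linear H -> H}) x p1 p2 :
  metric_bounds L1 -> metric_bounds L2 ->
  forward_backward L1 x p1 -> forward_backward L2 x p2 ->
  `|x - p2| <= 2 * C / c * `|x - p1|.
Proof.
move=> L1b L2b fb1 fb2.
have := A_mono fb1 fb2.
have -> : p1 - p2 = (x - p2) - (x - p1).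
  by apply: inner_inj => w; rewrite !innerE; ring.
move: (x - p1) (x - p2) => v1 v2.
have -> : L1 v1 - B x - (L2 v2 - B x) = L1 v1 - L2 v2.
  by rewrite opprB addrA subrK.
have [v10 _] := L1b v1; have [v20 _] := L2b v2.
have c1 : 0 <= c * `|v1| ^+ 2 by rewrite mulr_ge0 ?exprn_ge0 // ltW.
have i1 : '[v2, L1 v1] <= C * `|v1| * `|v2|.
  rewrite innerC; apply: le_trans (inner_le_norm _ _) _.
  by rewrite ler_wpM2r // (L1b v1).2.
have i2 : '[v1, L2 v2] <= C * `|v1| * `|v2|.
  rewrite innerC; apply: le_trans (inner_le_norm _ _) _.
  by rewrite mulrAC ler_wpM2r // (L2b v2).2.
rewrite !innerE (innerC v1 (L1 _)) (innerC v2 (L2 _)) => h.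
have key : c * `|v2| ^+ 2 <= 2 * C * `|v1| * `|v2| by lra.
rewrite mulrAC ler_pdivlMr // mulrC.
have [->|v2n0] := eqVneq `|v2| 0.
  rewrite mulr0; have [->|v1n0] := eqVneq `|v1| 0; first by rewrite mulr0.
  have v1_gt0 : 0 < `|v1| by rewrite lt_def v1n0 /=.
  have := le_trans (normr_ge0 _) (L1b v1).2.
  by lra.
have v2_gt0 : 0 < `|v2| by rewrite lt_def v2n0 /=.
by rewrite -(ler_pM2r v2_gt0) -mulrA -expr2.
Qed.

Lemma residual_lipschitz (L : {linear H -> H}) x x' p p' :
  metric_bounds L -> forward_backward L x p -> forward_backward L x' p' ->
  `|(x - p) - (x' - p')| <= (1 + (C + beta^-1) / c) * `|x - x'|.
Proof.
move=> Lb fb fb'; have := A_mono fb fb'.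
have -> : L (x - p) - B x - (L (x' - p') - B x') =
    L (x - x') - L (p - p') - (B x - B x').
  by apply: inner_inj => w; rewrite !(linearD L, linearN L) !innerE; ring.
have := (Lb (p - p')).1.
have : '[p - p', L (x - x')] <= C * `|x - x'| * `|p - p'|.
  rewrite innerC; apply: le_trans (inner_le_norm _ _) _.
  by rewrite ler_wpM2r // (Lb _).2.
have : - '[p - p', B x - B x'] <= beta^-1 * `|x - x'| * `|p - p'|.
  have := inner_ge_norm (p - p') (B x - B x').
  have : `|p - p'| * `|B x - B x'| <= `|p - p'| * (beta^-1 * `|x - x'|).
    by rewrite ler_wpM2l // cocoercive_lipschitz.
  by lra.
have h : `|x - p - (x' - p')| <= `|x - x'| + `|p - p'|.
  rewrite (_ : x - p - (x' - p') = (x - x') - (p - p')); last first.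
    by rewrite !opprD !opprK addrACA.
  exact: ler_normB.
move=> h1 h2 h3; rewrite (innerDr _ (- (B x - B x'))) innerNr.
rewrite (innerDr _ (- L (p - p'))) innerNr (innerC (p - p') (L (p - p'))) => h4.
apply: le_trans h _; rewrite mulrDl mul1r lerD2l mulrAC ler_pdivlMr // mulrC.
have key : c * `|p - p'| ^+ 2 <= (C + beta^-1) * `|x - x'| * `|p - p'| by lra.
have [->|pn0] := eqVneq `|p - p'| 0.
  rewrite mulr0; have [->|xn0] := eqVneq `|x - x'| 0; first by rewrite mulr0.
  have x_gt0 : 0 < `|x - x'| by rewrite lt_def xn0 /=.
  have := le_trans (normr_ge0 _) (Lb (x - x')).2.
  rewrite pmulr_lge0 // => C0; rewrite mulr_ge0 // addr_ge0 // invr_ge0.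
  exact: ltW.
have p_gt0 : 0 < `|p - p'| by rewrite lt_def pn0 /=.
by rewrite -(ler_pM2r p_gt0) -mulrA -expr2.
Qed.

End Comparison.

Section Metric.
Variables (alpha : R) (U Q : {linear H -> H}).
Hypotheses (alpha0 : 0 < alpha) (PU : Pclass alpha U) (QE : inv_op U = Q).
Variable g : R.
Hypotheses (g0 : 0 < g).

Let Qsa : self_adjoint Q := inv_self_adjoint alpha0 PU QE.
Let Qge0 x : 0 <= '[Q x, x] := inv_quadratic_ge0 alpha0 PU QE x.

Lemma resolventP y : exists u,
  A (resolvent (image_op (g \*: U) A) y) u /\
  resolvent (image_op (g \*: U) A) y + g *: U u = y.
Proof.
have Pg : Pclass (g * alpha) (g \*: U : {linear H -> H}).
  have [Ubd Usa _] := PU; split=> [r|x z|z].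
  - have [M UM] := Ubd r; exists (g * M) => z /UM zM.
    by rewrite /= normrZ gtr0_norm // ler_pM2l.
  - by rewrite /= innerZl innerZr Usa.
  - rewrite /= !innerZl -mulrA ler_pM2l // inner_norm2.
    exact: Pclass_ge PU.
have [p [u [Apu pu]]] := minty y (mulr_gt0 g0 alpha0) Pg A_max.
have fp : [set p | add_op (image_op (g \*: U) A) idfun p y] p.
  by exists (g *: U u); [exists u|rewrite addrC].
have [_ [u' Au' <-] yE] := xgetPex 0 (ex_intro _ p fp).
by exists u'; split => //; rewrite addrC; exact: yE.
Qed.

Lemma resolvent_forward_backward x :
  forward_backward (g^-1 \*: Q) x
    (resolvent (image_op (g \*: U) A) (x - g *: U (B x))).
Proof.
have [u] := resolventP (x - g *: U (B x)).
set p := resolvent _ _ => -[Apu pu]; rewrite /forward_backward /=.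
suff -> : g^-1 *: Q (x - p) - B x = u by [].
have -> : x - p = g *: U (u + B x).
  apply: inner_inj => w; have := congr1 (fun z => '[z, w]) pu.
  by rewrite (linearD U) !innerE; lra.
rewrite (linearZZ Q) (QU alpha0 PU QE) scalerA mulVf ?gt_eqF //.
by rewrite scale1r addrK.
Qed.

(** Pairing Q (y - y') with the difference of the images leaves a nonnegative
    monotonicity term; conclude by Cauchy-Schwarz for Q. *)
Lemma wnorm_resolvent y y' :
  wnorm Q (resolvent (image_op (g \*: U) A) y
           - resolvent (image_op (g \*: U) A) y') <= wnorm Q (y - y').
Proof.
have [u] := resolventP y; have [u'] := resolventP y'.
set p := resolvent _ y; set p' := resolvent _ y'.
move=> [Au' pu'] [Au pu].
have h : '[Q (p - p'), p - p'] <= '[Q (y - y'), p - p'].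
  have -> : y - y' = (p - p') + g *: U (u - u').
    by rewrite -pu -pu' (linearB U) scalerBr opprD addrACA.
  rewrite (linearD Q (p - p')) (linearZZ Q) (QU alpha0 PU QE).
  rewrite innerDl innerZl lerDl.
  by rewrite mulr_ge0 ?(ltW g0) // innerC; exact: A_mono.
have := le_trans h (wnorm_CauchySchwarz Qsa Qge0 _ _).
rewrite -(wnorm2 Qge0) expr2.
have [->|pn0] := eqVneq (wnorm Q (p - p')) 0; first by rewrite wnorm_ge0.
by rewrite ler_pM2r // lt_def pn0 wnorm_ge0.
Qed.

Lemma wnorm_le x : wnorm Q x <= (Num.sqrt alpha)^-1 * `|x|.
Proof.
rewrite -(@ler_pXn2r _ 2) ?nnegrE ?mulr_ge0 ?invr_ge0 ?sqrtr_ge0 //.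
  rewrite (wnorm2 Qge0) exprMn exprVn sqr_sqrtr ?(ltW alpha0) //.
  by have := inv_quadratic_le alpha0 PU QE x.
Qed.


Lemma monotone_step x p xs : zer (add_op A B) xs ->
  forward_backward (g^-1 \*: Q) x p ->
  g * '[B x - B xs, p - xs] <= '[Q (x - p), p - xs].
Proof.
move=> xsO fbx; have := A_mono fbx ((zerP xs).1 xsO); rewrite /= opprK.
rewrite -addrA (addrC (- B x)) -(opprB (B x)) innerDr innerNr innerZr.
rewrite !(innerC (p - xs)) subr_ge0 => h.
by rewrite -(ler_pM2l g0) mulrA mulfV ?gt_eqF // mul1r in h.
Qed.

Lemma cocoercive_step x p xs :
  beta * `|B x - B xs| ^+ 2 <= '[B x - B xs, p - xs] + '[B x - B xs, x - p].
Proof.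
have := B_coco x xs; rewrite innerC -innerDr.
by rewrite (_ : p - xs + (x - p) = x - xs) // addrC addrA subrK.
Qed.

(** The vectors v, s and d stand for x - p, p - xs and B x - B xs, where p is
    the image of x and xs is a solution. *)
Section Descent.
Variables v s d : H.
Hypotheses (mono_step : g * '[d, s] <= '[Q v, s])
  (coco_step : beta * `|d| ^+ 2 <= '[d, s] + '[d, v]).

Local Notation N := (opnorm U).
Local Notation e := (d - (2 * beta)^-1 *: v).
Local Notation f := (N *: Q v - v).

(** The decrease of the squared Q-distance to a solution per unit of
    relaxation, for the largest relaxation parameter 2 - g N / (2 beta). *)
Definition descent_gap :=
  2 * '[Q v, s] + g * N / (2 * beta) * '[Q v, v].

Lemma forward_bound : g * beta * `|d| ^+ 2 <= '[Q v, s] + g * '[d, v].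
Proof.
have : g * (beta * `|d| ^+ 2) <= g * ('[d, s] + '[d, v]) by rewrite ler_pM2l.
by move: mono_step; lra.
Qed.

Let N_ge0 : 0 <= N.
Proof. by apply: opnorm_ge0; case: PU. Qed.

Let b2_gt0 : 0 < 2 * beta.
Proof. by rewrite mulr_gt0. Qed.

Let f_sqr_le : `|f| ^+ 2 <= N / alpha * '[f, v].
Proof.
have -> : f = (N \*: Q \- idfun : {linear H -> H}) v by [].
apply: norm2_le_quadratic => [z w|z] /=.
  by rewrite !innerE Qsa.
rewrite !innerE inner_norm2 subr_ge0 (inv_quadratic_ge alpha0 PU QE) /=.
have : N * '[Q z, z] <= N * (alpha^-1 * `|z| ^+ 2).
  by rewrite ler_wpM2l // (inv_quadratic_le alpha0 PU QE).
have z2 : 0 <= `|z| ^+ 2 by exact: exprn_ge0.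
by lra.
Qed.

Let fv_ge0 : 0 <= '[f, v].
Proof.
by rewrite !innerE inner_norm2 subr_ge0 (inv_quadratic_ge alpha0 PU QE).
Qed.

(** Completing the square in the cocoercivity inequality and comparing
    |v|^2 with N <Q v, v>: the gap controls both defects e and f. *)
Lemma descent_gap_ge :
  2 * g * beta * `|e| ^+ 2 + g / (2 * beta) * '[f, v] <= descent_gap.
Proof.
have := forward_bound; rewrite /descent_gap -!inner_norm2 !innerE.
rewrite (innerC v d) => h.
rewrite [leLHS](_ : _ = 2 * (g * beta * '[d, d] - g * '[d, v])
    + g * N / (2 * beta) * '[Q v, v]); last first.
  by field; rewrite gt_eqF.
by lra.
Qed.

Lemma descent_gap_ge0 : 0 <= descent_gap.
Proof.
apply: le_trans descent_gap_ge; rewrite addr_ge0 // mulr_ge0 ?exprn_ge0 //.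
- by rewrite !mulr_ge0 // ltW.
- by rewrite divr_ge0 // ltW.
Qed.

Lemma relaxed_decrease (l : R) :
  0 <= l -> l <= 2 - g * N / (2 * beta) ->
  '[Q (v + s - l *: v), v + s - l *: v] <=
  '[Q (v + s), v + s] - l * descent_gap.
Proof.
move=> l0 l2.
rewrite (linearB Q) (linearZZ Q) (linearD Q) !innerE.
rewrite (_ : '[Q s, v] = '[Q v, s]); last by rewrite Qsa innerC.
have : l * '[Q v, v] * (l + g * N / (2 * beta) - 2) <= 0.
  by rewrite mulr_ge0_le0 ?mulr_ge0 //; lra.
rewrite /descent_gap; move: (g * N / _) => t.
by lra.
Qed.

(** If d were exactly v / (2 beta) and Q v exactly v / N, monotonicity would
    read (1 - g N / (2 beta)) <Q v, s> >= 0, and the gap would dominate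
    |v|^2.  The defects e and f measure the failure of these two equalities
    and are themselves dominated by the gap. *)
Lemma residual_le_defects (S : R) :
  g * N <= 2 * beta -> `|s| <= S ->
  (1 - g * N / (2 * beta)) * (g / (2 * beta)) * `|v| ^+ 2 <=
  descent_gap + 2 * g * S * (`|e| + `|f| / (2 * beta)).
Proof.
move=> gN sS.
have k1 : 0 <= 1 - g * N / (2 * beta) by rewrite subr_ge0 ler_pdivrMr // mul1r.
have k2 : 0 <= g * N / (2 * beta).
  by rewrite divr_ge0 ?(ltW b2_gt0) // mulr_ge0 // ltW.
have h1 : g * '[e, s] - g / (2 * beta) * '[f, s] <=
    (1 - g * N / (2 * beta)) * '[Q v, s].
  move: mono_step; rewrite !innerE => h.
  have -> : g * ('[d, s] - (2 * beta)^-1 * '[v, s]) -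
    g / (2 * beta) * (N * '[Q v, s] - '[v, s]) =
    g * '[d, s] - g * N / (2 * beta) * '[Q v, s] by field; rewrite gt_eqF.
  by lra.
have eS : - (`|e| * S) <= '[e, s].
  by apply: le_trans (inner_ge_norm _ _); rewrite lerN2 ler_wpM2l.
have fS : '[f, s] <= `|f| * S.
  by apply: le_trans (inner_le_norm _ _) _; rewrite ler_wpM2l.
have h2 : - (g * S * (`|e| + `|f| / (2 * beta))) <=
    (1 - g * N / (2 * beta)) * '[Q v, s].
  apply: le_trans h1.
  have : g * - (`|e| * S) <= g * '[e, s] by rewrite ler_pM2l.
  have : g / (2 * beta) * '[f, s] <= g / (2 * beta) * (`|f| * S).
    by rewrite ler_pM2l // divr_gt0.
  have -> : g * S * (`|e| + `|f| / (2 * beta)) =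
    g * (`|e| * S) + g / (2 * beta) * (`|f| * S) by field; rewrite gt_eqF.
  move: (`|e| * S) (`|f| * S) '[e, s] '[f, s] (g / _) => *; lra.
have vN : g / (2 * beta) * `|v| ^+ 2 <= g * N / (2 * beta) * '[Q v, v].
  rewrite [leRHS](_ : _ = g / (2 * beta) * (N * '[Q v, v])); last first.
    by field; rewrite gt_eqF.
  by rewrite ler_pM2l ?divr_gt0 // (inv_quadratic_ge alpha0 PU QE).
have h3 : (1 - g * N / (2 * beta)) * descent_gap <= descent_gap.
  by rewrite ler_piMl ?descent_gap_ge0 // gerBl.
have h4 : (1 - g * N / (2 * beta)) * (g / (2 * beta) * `|v| ^+ 2) <=
    (1 - g * N / (2 * beta)) * (g * N / (2 * beta) * '[Q v, v]).
  by rewrite ler_wpM2l.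
move: h2 h3 h4; rewrite {1}/descent_gap.
by lra.
Qed.

Lemma defect_forward_le : `|e| ^+ 2 <= (2 * g * beta)^-1 * descent_gap.
Proof.
rewrite ler_pdivlMl ?mulr_gt0 //.
apply: le_trans descent_gap_ge; rewrite lerDl mulr_ge0 //.
by rewrite divr_ge0 // ltW.
Qed.

Lemma defect_metric_le :
  `|f| ^+ 2 <= N / alpha * (2 * beta / g) * descent_gap.
Proof.
have gap : g / (2 * beta) * '[f, v] <= descent_gap.
  apply: le_trans descent_gap_ge; rewrite lerDr mulr_ge0 ?exprn_ge0 //.
  by rewrite !mulr_ge0 // ltW.
have {}gap : '[f, v] <= 2 * beta / g * descent_gap.
  by rewrite -ler_pdivrMl ?divr_gt0 // invf_div.
apply: (le_trans f_sqr_le); rewrite -[leRHS]mulrA ler_wpM2l //.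
by rewrite divr_ge0 // ltW.
Qed.

End Descent.

Lemma norm_le_wnorm z : `|z| <= Num.sqrt (opnorm U) * wnorm Q z.
Proof.
have N0 : 0 <= opnorm U by apply: opnorm_ge0; case: PU.
rewrite -(@ler_pXn2r _ 2) ?nnegrE ?mulr_ge0 ?sqrtr_ge0 ?wnorm_ge0 //.
by rewrite exprMn sqr_sqrtr // (wnorm2 Qge0) (inv_quadratic_ge alpha0 PU QE).
Qed.

Lemma inv_metric_bounds (gl : R) : 0 < gl -> gl <= g ->
  g * opnorm U <= 2 * beta ->
  metric_bounds (2 * beta)^-1 (gl * alpha)^-1 (g^-1 \*: Q).
Proof.
move=> gl0 glg gN z; rewrite /=; split.
  rewrite innerZl ler_pdivrMl ?mulr_gt0 // [leRHS]mulrCA ler_pdivlMl //.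
  apply: le_trans (ler_wpM2l (ltW g0) (inv_quadratic_ge alpha0 PU QE z)) _.
  by rewrite mulrA ler_wpM2r.
rewrite normrZ gtr0_norm ?invr_gt0 // invfM -mulrA; apply: ler_pM => //.
- by rewrite invr_ge0 ltW.
- by rewrite lef_pV2.
- by have := norm_inv_le alpha0 PU QE z.
Qed.

End Metric.

(** The descent gap controls the fourth power of the residual, uniformly over
    the metrics and steps.  The gap being a decrease per unit of relaxation,
    summing it controls the residuals even when the relaxation parameters
    approach their upper bound, where the usual term in |v|^2, proportional to
    the distance to that bound, degenerates. *)
Lemma residual_quartic (alpha gl gu mu kappa S G : R) :
  0 < alpha -> 0 < gl -> 0 <= gu -> 0 <= mu -> 0 < kappa -> 0 <= S -> 0 <= G ->
  exists2 C, 0 <= C &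
    forall (U Q : {linear H -> H}) (g : R) v s d,
      Pclass alpha U -> inv_op U = Q -> gl <= g <= gu -> opnorm U <= mu ->
      kappa <= 1 - g * opnorm U / (2 * beta) ->
      g * '[d, s] <= '[Q v, s] -> beta * `|d| ^+ 2 <= '[d, s] + '[d, v] ->
      `|s| <= S -> descent_gap U Q g v s <= G ->
      `|v| ^+ 4 <= C * descent_gap U Q g v s.
Proof.
move=> alpha0 gl0 gu0 mu0 kappa0 S0 G0.
have b2 : 0 < 2 * beta by rewrite mulr_gt0.
pose t := kappa * (gl / (2 * beta)).
have t0 : 0 < t by rewrite mulr_gt0 ?divr_gt0.
pose c1 := 2 * gu * S; pose c2 := 2 * gu * S / (2 * beta).
have c10 : 0 <= c1 by rewrite !mulr_ge0.
have c20 : 0 <= c2 by rewrite divr_ge0 // ltW.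
pose m := mu / alpha * (2 * beta / gl).
have m0 : 0 <= m by rewrite mulr_ge0 ?divr_ge0 // ltW.
pose C := 3 * (G + c1 ^+ 2 * (2 * gl * beta)^-1 + c2 ^+ 2 * m).
have C0 : 0 <= C.
  rewrite mulr_ge0 // !addr_ge0 // mulr_ge0 ?sqr_ge0 //.
  by rewrite invr_ge0 !mulr_ge0 // ltW.
exists (C / t ^+ 2); first by rewrite divr_ge0 ?sqr_ge0.
move=> U Q g v s d PU QE /andP[glg ggu] Nmu kap mono coco sS gapG.
have g0 : 0 < g by exact: lt_le_trans glg.
have N0 : 0 <= opnorm U by apply: opnorm_ge0; case: PU.
have gN : g * opnorm U <= 2 * beta.
  by rewrite -[leRHS]mul1r -ler_pdivrMr //; move: kap kappa0; lra.
have gap0 := descent_gap_ge0 alpha0 PU QE g0 mono coco.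
have v_le := residual_le_defects alpha0 PU QE g0 mono coco gN sS.
have e_le := defect_forward_le alpha0 PU QE g0 mono coco.
have f_le := defect_metric_le alpha0 PU QE g0 mono coco.
move: gap0 gapG v_le e_le f_le.
move: (descent_gap U Q g v s) `|d - _| (normr_ge0 (d - (2 * beta)^-1 *: v))
  `|_ - v| (normr_ge0 (opnorm U *: Q v - v)) => G' e e0 f f0.
move=> G'0 G'G v_le e_le f_le.
have {}v_le : t * `|v| ^+ 2 <= G' + c1 * e + c2 * f.
  apply: (@le_trans _ _
      ((1 - g * opnorm U / (2 * beta)) * (g / (2 * beta)) * `|v| ^+ 2)).
    rewrite ler_wpM2r ?exprn_ge0 //; apply: ler_pM => //; first exact: ltW.
      by rewrite divr_ge0 // ltW.
    by rewrite ler_wpM2r // invr_ge0 ltW.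
  apply: le_trans v_le _; rewrite -addrA lerD2l mulrDr.
  have -> : 2 * g * S * e = g * (2 * S * e) by ring.
  have -> : 2 * g * S * (f / (2 * beta)) = g * (2 * S * (f / (2 * beta))) by ring.
  have -> : c1 * e = gu * (2 * S * e) by rewrite /c1; ring.
  have -> : c2 * f = gu * (2 * S * (f / (2 * beta))) by rewrite /c2; ring.
  by rewrite lerD // ler_wpM2r // !mulr_ge0 // invr_ge0 ltW.
have {}e_le : e ^+ 2 <= (2 * gl * beta)^-1 * G'.
  apply: le_trans e_le _; rewrite ler_wpM2r // lef_pV2 ?posrE ?mulr_gt0 //.
  by rewrite ler_pM2r // ler_pM2l.
have {}f_le : f ^+ 2 <= m * G'.
  apply: le_trans f_le _; rewrite ler_wpM2r //.
  apply: ler_pM; rewrite ?divr_ge0 ?(ltW b2) ?(ltW alpha0) ?(ltW g0) //.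
    by rewrite ler_wpM2r // invr_ge0 ltW.
  by rewrite ler_pM2l // lef_pV2.
have sq3 (r1 r2 r3 : R) :
    (r1 + r2 + r3) ^+ 2 <= 3 * (r1 ^+ 2 + r2 ^+ 2 + r3 ^+ 2).
  have := sqr_ge0 (r1 - r2); have := sqr_ge0 (r1 - r3).
  by have := sqr_ge0 (r2 - r3); lra.
rewrite mulrAC ler_pdivlMr ?exprn_gt0 // mulrC (_ : 4 = 2 * 2)%N // exprM -exprMn.
apply: (@le_trans _ _ ((G' + c1 * e + c2 * f) ^+ 2)).
  have tv0 : 0 <= t * `|v| ^+ 2.
    by apply: mulr_ge0; [exact: ltW|exact: exprn_ge0].
  by rewrite ler_pXn2r ?nnegrE // (le_trans tv0 v_le).
apply: le_trans (sq3 _ _ _) _; rewrite /C -[leRHS]mulrA ler_pM2l // mulrDl mulrDl.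
rewrite [(c1 * e) ^+ 2]exprMn [(c2 * f) ^+ 2]exprMn.
apply: lerD; first apply: lerD.
- by rewrite expr2 ler_wpM2r.
- by rewrite -[leRHS]mulrA ler_wpM2l ?sqr_ge0.
- by rewrite -[leRHS]mulrA ler_wpM2l ?sqr_ge0.
Qed.

End ForwardBackward.

(** Inversion reverses the Loewner order: <Q x, x> is the maximum over z of
    2 <x, z> - <U z, z>. *)
Lemma inv_loewner (R : realType) (H : hilbertType R) (alpha c : R)
    (U Q U' Q' : {linear H -> H}) (x : H) :
  0 < alpha -> Pclass alpha U -> Pclass alpha U' -> inv_op U = Q ->
  inv_op U' = Q' -> 0 < c -> loewner_ge (c \*: U') U ->
  inner (Q' x) x <= c * inner (Q x) x.
Proof.
move=> alpha0 PU PU' QE QE' c0 UU'; have Usa : self_adjoint U by case: PU.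
have := UU' (c^-1 *: Q' x).
have := Pclass_ge0 (Q x - c^-1 *: Q' x) alpha0 PU.
rewrite /= (linearB U) !(linearZZ U) !(linearZZ U').
rewrite (UQ alpha0 PU QE) (UQ alpha0 PU' QE') !innerE.
rewrite (Usa (Q' x) (Q x)) (UQ alpha0 PU QE) !(innerC x).
rewrite (mulrA c) mulfV ?gt_eqF // mul1r => h1 h2; rewrite -ler_pdivrMl //.
by move: h1 h2; lra.
Qed.

(** * The variable metric forward-backward iteration *)

Section Iteration.
Variables (R : realType) (H : hilbertType R).
Local Notation "'[ x , y ]" := (@inner R H x y).
Variables (A : H -> set H) (B : H -> H) (beta alpha : R).
Hypotheses (A_max : maximal_monotone A) (beta0 : 0 < beta)
  (B_coco : cocoercive beta B) (alpha0 : 0 < alpha).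
Variables (eta gamma lambda : nat -> R) (U Q : nat -> {linear H -> H}).
Hypotheses (eta0 : forall k, 0 <= eta k) (eta_sum : cvgn (series eta))
  (PU : forall k, Pclass alpha (U k)) (QE : forall k, inv_op (U k) = Q k)
  (U_mono : forall k, loewner_ge ((1 + eta k) \*: U k.+1) (U k))
  (gamma0 : forall k, 0 < gamma k)
  (gammaN : forall k, gamma k * opnorm (U k) <= 2 * beta)
  (lambda0 : forall k, 0 <= lambda k)
  (lambda_lt : forall k,
     lambda k <= 2 - gamma k * opnorm (U k) / (2 * beta)).
Variables (a b x : nat -> H).
Hypotheses (a_sum : cvgn (series (fun k => lambda k * `|a k|)))
  (b_sum : cvgn (series (fun k => lambda k * `|b k|))).

Local Notation J k := (resolvent (image_op (gamma k \*: U k) A)).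
Local Notation T k z := (J k (z - gamma k *: U k (B z))).

Hypothesis x_step : forall k, x k.+1 = x k + lambda k *:
  (J k (x k - gamma k *: U k (B (x k) + b k)) + a k - x k).

Definition residual k := x k - T k (x k).
Local Notation v := residual.

Definition perturbation k := x k.+1 - (x k - lambda k *: v k).
Local Notation err := perturbation.

Definition perturbation_bound k := (Num.sqrt alpha)^-1 *
  (lambda k * `|a k| + 2 * beta * (lambda k * `|b k|)).

Local Notation eps := perturbation_bound.

Let Q_ge0 k z : 0 <= '[Q k z, z].
Proof. exact (inv_quadratic_ge0 alpha0 (PU k) (QE k) z). Qed.

Let Q_sa k : self_adjoint (Q k).
Proof. exact (inv_self_adjoint alpha0 (PU k) (QE k)). Qed.

Let eps_ge0 k : 0 <= eps k.
Proof.
by rewrite mulr_ge0 ?invr_ge0 ?sqrtr_ge0 // addr_ge0 ?mulr_ge0 // ltW.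
Qed.

Let eps_sum : cvgn (series eps).
Proof.
apply: summableZ; apply: summableD => //.
exact: summableZ.
Qed.

Let wnormZ k (c : R) z : 0 <= c -> wnorm (Q k) (c *: z) = c * wnorm (Q k) z.
Proof.
move=> c0; rewrite /wnorm (linearZZ (Q k)) innerZl innerZr mulrA.
by rewrite sqrtrM ?mulr_ge0 // -expr2 sqrtr_sqr ger0_norm.
Qed.

Lemma error_le k : wnorm (Q k) (err k) <= eps k.
Proof.
have -> : err k = lambda k *:
    ((J k (x k - gamma k *: U k (B (x k) + b k)) - T k (x k)) + a k).
  by apply: inner_inj => w; rewrite /perturbation /residual x_step !innerE; ring.
have sa : 0 <= (Num.sqrt alpha)^-1 by rewrite invr_ge0 sqrtr_ge0.
rewrite wnormZ // /perturbation_bound [2 * beta * _]mulrCA -mulrDr mulrCA.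
rewrite ler_wpM2l //.
apply: le_trans (wnormD (Q_sa k) (Q_ge0 k) _ _) _.
rewrite addrC mulrDr; apply: lerD; first exact: wnorm_le alpha0 (PU k) (QE k) _.
apply: le_trans (wnorm_resolvent A_max alpha0 (PU k) (QE k) (gamma0 k) _ _) _.
apply: le_trans (wnorm_le alpha0 (PU k) (QE k) _) _; rewrite ler_wpM2l //.
rewrite (_ : _ - _ = - (gamma k *: U k (b k))); last first.
  by apply: inner_inj => w; rewrite (linearD (U k)) !innerE; ring.
rewrite normrN normrZ gtr0_norm //.
have Ubd : bounded_fun_norm (U k) by case: (PU k).
apply: le_trans (ler_wpM2l (ltW (gamma0 k)) (norm_le_opnorm Ubd (b k))) _.
by rewrite mulrA ler_wpM2r.
Qed.

Lemma quadratic_next k z : '[Q k.+1 z, z] <= (1 + eta k) * '[Q k z, z].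
Proof.
have e0 : 0 < 1 + eta k by rewrite ltr_wpDr.
exact: (inv_loewner z alpha0 (PU k) (PU k.+1) (QE k) (QE k.+1) e0 (U_mono k)).
Qed.

Lemma wnorm_next k z : wnorm (Q k.+1) z <= (1 + eta k) * wnorm (Q k) z.
Proof.
have e1 : 1 <= 1 + eta k by rewrite lerDl.
have e0 : 0 <= 1 + eta k by exact: le_trans e1.
rewrite -(@ler_pXn2r _ 2) ?nnegrE ?mulr_ge0 ?wnorm_ge0 //.
rewrite exprMn !wnorm2 //; apply: le_trans (quadratic_next k z) _.
by rewrite ler_wpM2r // expr2 ler_peMl.
Qed.

Section Solution.
Variable xs : H.
Hypothesis xsO : zer (add_op A B) xs.

Local Notation s k := (T k (x k) - xs).
Local Notation d k := (B (x k) - B xs).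

Definition gap k := descent_gap beta (U k) (Q k) (gamma k) (v k) (s k).

Let fb k : forward_backward A B ((gamma k)^-1 \*: Q k) (x k) (T k (x k)).
Proof.
exact (resolvent_forward_backward B A_max alpha0 (PU k) (QE k) (gamma0 k) (x k)).
Qed.

Let mono k : gamma k * '[d k, s k] <= '[Q k (v k), s k].
Proof. exact (monotone_step A_max (gamma0 k) xsO (fb k)). Qed.

Let coco k : beta * `|d k| ^+ 2 <= '[d k, s k] + '[d k, v k].
Proof. exact: cocoercive_step. Qed.

Let gap_ge0 k : 0 <= gap k.
Proof.
exact (descent_gap_ge0 beta0 alpha0 (PU k) (QE k) (gamma0 k) (mono k) (coco k)).
Qed.

Lemma relaxed_step_le k :
  wnorm (Q k) (x k - lambda k *: v k - xs) ^+ 2 <=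
  wnorm (Q k) (x k - xs) ^+ 2 - lambda k * gap k.
Proof.
rewrite !wnorm2 //.
have -> : x k - xs = v k + s k.
  by apply: inner_inj => w; rewrite /residual !innerE; ring.
have -> : x k - lambda k *: v k - xs = v k + s k - lambda k *: v k.
  by apply: inner_inj => w; rewrite /residual !innerE; ring.
exact: (relaxed_decrease alpha0 (PU k) (QE k) _ _ (lambda0 k) (lambda_lt k)).
Qed.

Lemma relaxed_step_wnorm k :
  wnorm (Q k) (x k - lambda k *: v k - xs) <= wnorm (Q k) (x k - xs).
Proof.
rewrite -(@ler_pXn2r _ 2) ?nnegrE ?wnorm_ge0 //.
by apply: le_trans (relaxed_step_le k) _; rewrite gerBl mulr_ge0.
Qed.

Lemma next_wnorm_le k : wnorm (Q k) (x k.+1 - xs) <=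
  wnorm (Q k) (x k - lambda k *: v k - xs) + eps k.
Proof.
have -> : x k.+1 - xs = (x k - lambda k *: v k - xs) + err k.
  by apply: inner_inj => w; rewrite /perturbation !innerE; ring.
by apply: le_trans (wnormD (Q_sa k) (Q_ge0 k) _ _) _; rewrite lerD2l error_le.
Qed.

(** A relaxed step does not increase the Q-distance to xs, the perturbations are
    summable, and the change of metric costs a factor 1 + eta k. *)
Lemma wnorm_dist_cvgn : cvgn (fun k => wnorm (Q k) (x k - xs)).
Proof.
apply: (@quasi_nonincreasing_cvgn _ _ eta eps) => //.
  by move=> k; exact: wnorm_ge0.
move=> k; apply: le_trans (wnorm_next k _) _.
rewrite ler_wpM2l ?addr_ge0 //; apply: le_trans (next_wnorm_le k) _.
by rewrite lerD2r relaxed_step_wnorm.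
Qed.

(** The squared quasi-Fejer inequality, keeping the gap, telescopes. *)
Lemma gap_summable : cvgn (series (fun k => lambda k * gap k)).
Proof.
have [S S0 sS] := cvgn_ubound wnorm_dist_cvgn.
have eps0 : eps @ \oo --> (0 : R) by exact: cvg_series_cvg_0.
have [M M0 epsM] := cvgn_ubound (cvgP _ eps0).
pose K := 2 * S + M.
have K0 : 0 <= K by rewrite addr_ge0 // mulr_ge0.
pose delta k := K * eps k + (S ^+ 2 + K * M) * eta k.
apply: (@summable_decrease _ (fun k => wnorm (Q k) (x k - xs) ^+ 2) _ delta).
- by move=> k; exact: sqr_ge0.
- by move=> k; exact: mulr_ge0.
- by apply: summableD; exact: summableZ.
move=> k; set E := wnorm (Q k) (x k - xs) ^+ 2.
have E_le : E <= S ^+ 2 by rewrite ler_pXn2r ?nnegrE ?wnorm_ge0.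
have step : '[Q k (x k.+1 - xs), x k.+1 - xs] <= E - lambda k * gap k + K * eps k.
  rewrite -wnorm2 //; apply: (@le_trans _ _
    ((wnorm (Q k) (x k - lambda k *: v k - xs) + eps k) ^+ 2)).
    by rewrite ler_pXn2r ?nnegrE ?addr_ge0 ?wnorm_ge0 ?next_wnorm_le.
  rewrite sqrrD -addrA; apply: lerD; first exact: relaxed_step_le.
  have wS := le_trans (relaxed_step_wnorm k) (sS k).
  have : wnorm (Q k) (x k - lambda k *: v k - xs) * eps k <= S * eps k.
    by rewrite ler_wpM2r.
  have : eps k * eps k <= M * eps k by rewrite ler_wpM2r.
  by rewrite /K expr2; lra.
rewrite wnorm2 //; apply: le_trans (quadratic_next k _) _.
apply: le_trans (ler_wpM2l _ step) _; first by rewrite addr_ge0.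
have : eta k * (E - lambda k * gap k + K * eps k) <= eta k * (S ^+ 2 + K * M).
  rewrite ler_wpM2l // lerD //; last by rewrite ler_wpM2l.
  by apply: le_trans E_le; rewrite gerBl mulr_ge0.
by rewrite /delta; lra.
Qed.

Section BoundedSteps.
Variables (mu gl gu kappa : R).
Hypotheses (mu0 : 0 < mu) (U_le : forall k, opnorm (U k) <= mu)
  (gl0 : 0 < gl) (gl_le : forall k, gl <= gamma k)
  (gu_ge : forall k, gamma k <= gu) (kappa0 : 0 < kappa)
  (kappa_le : forall k, kappa <= 1 - gamma k * opnorm (U k) / (2 * beta)).

Let c := (2 * beta)^-1.
Let C := (gl * alpha)^-1.
Let c0 : 0 < c. Proof. by rewrite invr_gt0 mulr_gt0. Qed.
Let C0 : 0 < C. Proof. by rewrite invr_gt0 mulr_gt0. Qed.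

Let metric k : metric_bounds c C ((gamma k)^-1 \*: Q k).
Proof.
exact (inv_metric_bounds beta0 alpha0 (PU k) (QE k) (gamma0 k) gl0 (gl_le k)
  (gammaN k)).
Qed.

Let norm_le_mu k z : `|z| <= Num.sqrt mu * wnorm (Q k) z.
Proof.
apply: le_trans (norm_le_wnorm alpha0 (PU k) (QE k) z) _.
by rewrite ler_wpM2r ?wnorm_ge0 // ler_wsqrtr.
Qed.

Lemma iterates_bounded : exists2 X, 0 <= X & forall k, `|x k - xs| <= X.
Proof.
have [S S0 sS] := cvgn_ubound wnorm_dist_cvgn.
exists (Num.sqrt mu * S) => [|k]; first by rewrite mulr_ge0 ?sqrtr_ge0.
apply: le_trans (norm_le_mu k _) _.
by rewrite ler_wpM2l ?sqrtr_ge0.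
Qed.

Let lip := 1 + (C + beta^-1) / c.
Let lip0 : 0 <= lip.
Proof.
rewrite addr_ge0 // divr_ge0 ?(ltW c0) // addr_ge0 ?(ltW C0) //.
by rewrite invr_ge0 ltW.
Qed.

Let v_le k : `|v k| <= lip * `|x k - xs|.
Proof.
have fbs : forward_backward A B ((gamma k)^-1 \*: Q k) xs xs.
  exact: (forward_backward_zer ((gamma k)^-1 \*: Q k : {linear H -> H}) xsO).
have := residual_lipschitz A_max beta0 B_coco c0 (metric k) (fb k) fbs.
by rewrite subrr subr0.
Qed.

Lemma residual_quartic_summable :
  cvgn (series (fun k => lambda k * `|v k| ^+ 4)).
Proof.
have [X X0 xX] := iterates_bounded.
pose V := lip * X; have V0 : 0 <= V by exact: mulr_ge0.
have vV k : `|v k| <= V by apply: le_trans (v_le k) _; rewrite ler_wpM2l.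
pose S := X + V; have S0 : 0 <= S by exact: addr_ge0.
have sS k : `|s k| <= S.
  have -> : s k = (x k - xs) - v k.
    by apply: inner_inj => w; rewrite /residual !innerE; ring.
  by apply: le_trans (ler_normB _ _) _; rewrite lerD.
pose G := alpha^-1 * (2 * (V * S) + V * V).
have a0 : 0 <= alpha^-1 by rewrite invr_ge0 ltW.
have G0 : 0 <= G by rewrite mulr_ge0 ?addr_ge0 ?mulr_ge0.
have gapG k : gap k <= G.
  have Qv : `|Q k (v k)| <= alpha^-1 * V.
    apply: le_trans (norm_inv_le alpha0 (PU k) (QE k) (v k)) _.
    by rewrite ler_wpM2l.
  have h1 : '[Q k (v k), s k] <= alpha^-1 * V * S.
    by apply: le_trans (inner_le_norm _ _) _; apply: ler_pM.
  have h2 : '[Q k (v k), v k] <= alpha^-1 * V * V.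
    by apply: le_trans (inner_le_norm _ _) _; apply: ler_pM.
  have h3 : gamma k * opnorm (U k) / (2 * beta) * '[Q k (v k), v k] <=
      '[Q k (v k), v k].
    by rewrite ler_piMl // ler_pdivrMr ?mulr_gt0 // mul1r.
  by rewrite /gap /descent_gap /G; lra.
have gu0 : 0 <= gu by exact: le_trans (ltW (gamma0 0%N)) (gu_ge 0%N).
have [K K0 quartic] :=
  residual_quartic H beta0 alpha0 gl0 gu0 (ltW mu0) kappa0 S0 G0.
apply: (@summable_le _ _ (fun k => K * (lambda k * gap k))) => [k|]; last first.
  by apply: summableZ; exact: gap_summable.
rewrite mulr_ge0 ?exprn_ge0 //= [leRHS]mulrCA ler_wpM2l //.
apply: (quartic _ _ _ _ _ (d k) (PU k) (QE k)) => //.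
  by rewrite gl_le gu_ge.
exact (gapG k).
Qed.

(** The residual map of the initial metric serves as a yardstick that does not
    vary with k: along the iteration it changes by O(|x k.+1 - x k|), and it is
    comparable to the residuals v k. *)
Lemma residual_cvg0 :
  series lambda @ \oo --> +oo -> (fun k => `|v k|) @ \oo --> (0 : R).
Proof.
move=> lambda_oo.
have [X X0 xX] := iterates_bounded.
have fb0 z : forward_backward A B ((gamma 0)^-1 \*: Q 0) z (T 0%N z).
  exact (resolvent_forward_backward B A_max alpha0 (PU 0) (QE 0%N) (gamma0 0) z).
pose phi k := `|x k - T 0%N (x k)|.
pose D := 2 * C / c.
have D0 : 0 <= D by rewrite divr_ge0 ?mulr_ge0 ?(ltW C0) ?(ltW c0).
have phi_le k : phi k <= D * `|v k|.
  exact (residual_compare A_max c0 (metric k) (metric 0%N) (fb k) (fb0 (x k))).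
have v_phi k : `|v k| <= D * phi k.
  exact (residual_compare A_max c0 (metric 0%N) (metric k) (fb0 (x k)) (fb k)).
have lambda2 k : lambda k <= 2.
  apply: le_trans (lambda_lt k) _.
  rewrite gerBl divr_ge0 ?mulr_ge0 ?(ltW beta0) //.
    exact: ltW.
  by apply: opnorm_ge0; case: (PU k).
have move_le k : `|x k - x k.+1| <= lambda k * `|v k| + Num.sqrt mu * eps k.
  have -> : x k - x k.+1 = lambda k *: v k - err k.
    by apply: inner_inj => w; rewrite /perturbation !innerE; ring.
  apply: le_trans (ler_normB _ _) _; rewrite normrZ ger0_norm // lerD2l.
  apply: le_trans (norm_le_mu k _) _.
  by rewrite ler_wpM2l ?sqrtr_ge0 // error_le.
pose K := lip * D + lip * Num.sqrt mu.
have K1 : 0 <= lip * D by exact: mulr_ge0.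
have K2 : 0 <= lip * Num.sqrt mu by rewrite mulr_ge0 ?sqrtr_ge0.
have phi0 : phi @ \oo --> (0 : R).
  apply: (@slow_growth_cvg0 _ phi lambda eps K (D * (lip * X))) => //.
  - exact: addr_ge0.
  - move=> k; rewrite normr_ge0 /=; apply: le_trans (phi_le k) _.
    rewrite ler_wpM2l //; apply: le_trans (v_le k) _.
    by rewrite ler_wpM2l.
  - by move=> k; rewrite lambda0 lambda2.
  - move=> k.
    have h1 : phi k.+1 <= phi k + lip * `|x k - x k.+1|.
      have := residual_lipschitz A_max beta0 B_coco c0 (metric 0%N)
        (fb0 (x k)) (fb0 (x k.+1)).
      move=> h.
      have := ler_distD (x k - T 0%N (x k)) (0 : H) (x k.+1 - T 0%N (x k.+1)).
      by rewrite !sub0r !normrN => /le_trans; apply; rewrite lerD2l.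
    have h2 := ler_wpM2l lip0 (move_le k).
    have h3 : lambda k * `|v k| <= lambda k * (D * phi k) by rewrite ler_wpM2l.
    have h4 := ler_wpM2l lip0 h3.
    have h5 : 0 <= lip * Num.sqrt mu * (lambda k * phi k).
      by rewrite mulr_ge0 // mulr_ge0 // normr_ge0.
    have h6 : 0 <= lip * D * eps k by rewrite mulr_ge0.
    by rewrite /K; lra.
  - apply: (@summable_le _ _ (fun k => D ^+ 4 * (lambda k * `|v k| ^+ 4))).
      move=> k; rewrite mulr_ge0 ?exprn_ge0 ?normr_ge0 //= [leRHS]mulrCA.
      rewrite ler_wpM2l // -exprMn.
      have phi_ge0 : 0 <= phi k by exact: normr_ge0.
      by rewrite ler_pXn2r ?nnegrE ?phi_le // (le_trans phi_ge0 (phi_le k)).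
    by apply: summableZ; exact: residual_quartic_summable.
apply: (@squeeze_cvgr _ _ _ _ (fun=> 0) (fun k => D * phi k)).
- by apply: nearW => k; rewrite normr_ge0 v_phi.
- exact: cvg_cst.
- by rewrite -[X in _ --> X](mulr0 D); apply: cvgM => //; exact: cvg_cst.
Qed.

(** Monotonicity and cocoercivity bound |B (x k) - B xs|^2 by a multiple of the
    residual. *)
Lemma forward_cvg : (fun k => `|v k|) @ \oo --> (0 : R) ->
  B (x k) @[k --> \oo] --> B xs.
Proof.
move=> v0; have [X X0 xX] := iterates_bounded.
pose S := X + lip * X.
have sS k : `|s k| <= S.
  have -> : s k = (x k - xs) - v k.
    by apply: inner_inj => w; rewrite /residual !innerE; ring.
  apply: le_trans (ler_normB _ _) _; rewrite lerD //.
  by apply: le_trans (v_le k) _; rewrite ler_wpM2l.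
pose K := beta^-1 * (C * S + beta^-1 * X).
have d_le k : `|d k| ^+ 2 <= K * `|v k|.
  rewrite /K -mulrA ler_pdivlMl //.
  have h := forward_bound (gamma0 k) (mono k) (coco k).
  have h1 : beta * `|d k| ^+ 2 <= (gamma k)^-1 * '[Q k (v k), s k] + '[d k, v k].
    rewrite -(ler_pM2l (gamma0 k)) mulrDr (mulrA _ beta).
    rewrite (mulrA _ (gamma k)^-1) mulfV ?gt_eqF // mul1r.
    exact: h.
  apply: le_trans h1 _; rewrite mulrDl; apply: lerD.
    rewrite -innerZl; apply: le_trans (inner_le_norm _ _) _.
    rewrite mulrAC; apply: ler_pM => //.
    exact (metric k (v k)).2.
  apply: le_trans (inner_le_norm _ _) _; rewrite ler_wpM2r //.
  apply: le_trans (cocoercive_lipschitz beta0 B_coco _ _) _.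
  by rewrite ler_wpM2l // invr_ge0 ltW.
have d0 : (fun k => K * `|v k|) @ \oo --> (0 : R).
  by rewrite -[X in _ --> X](mulr0 K); apply: cvgM => //; exact: cvg_cst.
apply/cvgrPdist_lt => e e0; have e2 : 0 < e ^+ 2 by rewrite exprn_gt0.
move/cvgrPdist_lt: d0 => /(_ _ e2); apply: filterS => k.
rewrite sub0r normrN (distrC (B xs)) => h.
rewrite -(@ltr_pXn2r _ 2) ?nnegrE ?(ltW e0) //.
by apply: le_lt_trans h; apply: le_trans (ler_norm _); exact: d_le.
Qed.

(** With p k the image of x k, the vectors (gamma k)^-1 Q k (v k) - B (x k) lie
    in A (p k) and converge strongly to - B xs, while p k converges weakly to
    q; so - B xs is in A q, and cocoercivity gives B q = B xs. *)
Lemma weak_limit_zer (F : set_system nat) q : ProperFilter F -> \oo `<=` F ->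
  (fun k => `|v k|) @ \oo --> (0 : R) -> weak_lim F x q -> zer (add_op A B) q.
Proof.
move=> FP oo_F v0 xq; have [X X0 xX] := iterates_bounded.
have BxF : B (x k) @[k --> F] --> B xs.
  by move=> W nW; apply: oo_F; exact: forward_cvg.
have vF : v k @[k --> F] --> (0 : H).
  apply/cvgrPdist_lt => e e0; apply: oo_F; move/cvgrPdist_lt: v0 => /(_ e e0).
  by apply: filterS => k; rewrite !sub0r !normrN normr_id.
pose w k := (gamma k)^-1 *: Q k (v k) - B (x k).
have wF : w k @[k --> F] --> - B xs.
  rewrite -[X in _ --> X]sub0r; apply: cvgB => //.
  apply/cvgrPdist_le => e e0; have eC : 0 < e / C by rewrite divr_gt0.
  move/cvgrPdist_le: vF => /(_ _ eC); apply: filterS => k.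
  rewrite !sub0r !normrN ler_pdivlMr // mulrC; apply: le_trans.
  exact (metric k (v k)).2.
have pq y : '[T k (x k), y] @[k --> F] --> '[q, y].
  have -> : (fun k => '[T k (x k), y]) = (fun k => '[x k, y] - '[v k, y]).
    by apply/funext => k; rewrite /residual !innerE; ring.
  rewrite -[X in _ --> X]subr0 -(inner0l y); apply: cvgB; first exact: xq.
  by apply: cvg_inner => //; exact: cvg_cst.
have p_le k : `|T k (x k)| <= `|xs| + X + lip * X.
  have -> : T k (x k) = xs + (x k - xs) - v k.
    by apply: inner_inj => z; rewrite /residual !innerE; ring.
  apply: le_trans (ler_normB _ _) _; apply: lerD.
    by apply: le_trans (ler_normD _ _) _; rewrite lerD2l.
  by apply: le_trans (v_le k) _; rewrite ler_wpM2l.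
have Aq : A q (- B xs).
  exact (@maximal_monotone_closed R H A F _ (fun k => T k (x k)) w q _ _ A_max
    fb p_le pq wF).
suff Bq : B q = B xs by apply/(zerP A B q).2; rewrite Bq.
have h k : beta * `|B (x k) - B q| ^+ 2 <=
    (X + `|xs - q|) * `|B (x k) - B xs| + '[x k - q, B xs - B q].
  apply: le_trans (B_coco (x k) q) _.
  have -> : B (x k) - B q = (B (x k) - B xs) + (B xs - B q).
    by rewrite addrA subrK.
  rewrite innerDr lerD2r; apply: le_trans (inner_le_norm _ _) _.
  rewrite ler_wpM2r //; have -> : x k - q = (x k - xs) + (xs - q).
    by rewrite addrA subrK.
  by apply: le_trans (ler_normD _ _) _; rewrite lerD2r.
have lim_l : beta * `|B (x k) - B q| ^+ 2 @[k --> F] -->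
    beta * `|B xs - B q| ^+ 2.
  apply: cvgM; first exact: cvg_cst.
  have nl : `|B (x k) - B q| @[k --> F] --> `|B xs - B q|.
    by apply: cvg_norm; apply: cvgB => //; exact: cvg_cst.
  by rewrite expr2; apply: cvgM.
have lim_r : (X + `|xs - q|) * `|B (x k) - B xs| + '[x k - q, B xs - B q]
    @[k --> F] --> (X + `|xs - q|) * `|B xs - B xs| + ('[q, B xs - B q]
      - '[q, B xs - B q]).
  apply: cvgD.
    apply: cvgM; first exact: cvg_cst.
    by apply: cvg_norm; apply: cvgB => //; exact: cvg_cst.
  under eq_cvg do rewrite innerDl innerNl.
  by apply: cvgB; [exact: xq|exact: cvg_cst].
have : beta * `|B xs - B q| ^+ 2 <= 0.
  have := ler_cvg_to lim_l lim_r; rewrite !subrr normr0 mulr0 addr0; apply.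
  exact: nearW.
rewrite pmulr_rle0 // => Bq0; apply/eqP; rewrite eq_sym -subr_eq0 -normr_le0.
by rewrite -(@ler_pXn2r _ 2) ?nnegrE // expr0n.
Qed.

End BoundedSteps.
End Solution.

(** Opial's argument in variable metrics: the Q-distances to two solutions p
    and q converge, hence so do the <x k, Q k (p - q)>, and the Q k (p - q)
    converge strongly.  So <p, z> = <q, z> for z the limit of Q k (p - q). *)
Lemma weak_limits_eq (mu : R) (p q : H) (F G : set_system nat) :
  0 < mu -> (forall k, opnorm (U k) <= mu) ->
  (forall z, cvgn (fun k => Q k z)) ->
  zer (add_op A B) p -> zer (add_op A B) q ->
  ProperFilter F -> ProperFilter G -> \oo `<=` F -> \oo `<=` G ->
  weak_lim F x p -> weak_lim G x q -> p = q.
Proof.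
move=> mu0 U_le Q_cvg pO qO FP GP oo_F oo_G xp xq.
have sqr_cvg xs : zer (add_op A B) xs ->
    cvgn (fun k => '[Q k (x k - xs), x k - xs]).
  move=> /wnorm_dist_cvgn /cvg_ex[/= l xl]; apply/cvg_ex; exists (l * l).
  under eq_cvg do rewrite -wnorm2 // expr2.
  exact: cvgM.
have /cvg_ex[/= lp xlp] := sqr_cvg p pO; have /cvg_ex[/= lq xlq] := sqr_cvg q qO.
have /cvg_ex[/= z Qz] := Q_cvg (p - q).
have /cvg_ex[/= zp Qp] := Q_cvg p; have /cvg_ex[/= zq Qq] := Q_cvg q.
have [X X0 xX] := iterates_bounded pO U_le.
have xM k : `|x k| <= X + `|p|.
  by rewrite -[x k](subrK p) (le_trans (ler_normD _ _)) // lerD2r.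
have r_cvg : '[x k, Q k (p - q)] @[k --> \oo] -->
    2^-1 * ((lq - lp) - ('[zq, q] - '[zp, p])).
  have -> : (fun k => '[x k, Q k (p - q)]) = (fun k => 2^-1 *
      (('[Q k (x k - q), x k - q] - '[Q k (x k - p), x k - p])
       - ('[Q k q, q] - '[Q k p, p]))).
    apply/funext => k; rewrite !(linearB (Q k)) !innerE.
    rewrite (Q_sa k (x k) p) (Q_sa k (x k) q) (innerC (Q k p) (x k)).
    rewrite (innerC (Q k q) (x k)).
    by field.
  apply: cvgM; first exact: cvg_cst.
  apply: cvgB; first exact: cvgB.
  by apply: cvgB; apply: cvg_inner => //; exact: cvg_cst.
have xz : '[x k, z] @[k --> \oo] --> 2^-1 * ((lq - lp) - ('[zq, q] - '[zp, p])).
  rewrite -[X in _ --> X]addr0.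
  have -> : (fun k => '[x k, z]) =
      (fun k => '[x k, Q k (p - q)] + '[x k, z - Q k (p - q)]).
    by apply/funext => k; rewrite !innerDr innerNr; ring.
  apply: cvgD => //; apply/cvgrPdist_le => e e0.
  have M0 : 0 < X + `|p| + 1 by rewrite ltr_wpDl // addr_ge0.
  have eM : 0 < e / (X + `|p| + 1) by rewrite divr_gt0.
  move/cvgrPdist_le: Qz => /(_ _ eM); apply: filterS => k.
  rewrite ler_pdivlMr // sub0r normrN => h; apply: le_trans (CauchySchwarz _ _) _.
  apply: le_trans h; rewrite mulrC ler_wpM2l //.
  by apply: le_trans (xM k) _; rewrite lerDl.
have pqz : '[p, z] = '[q, z].
  have Fz : '[x k, z] @[k --> F] --> 2^-1 * ((lq - lp) - ('[zq, q] - '[zp, p])).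
    by move=> W nW; apply: oo_F; exact: xz.
  have Gz : '[x k, z] @[k --> G] --> 2^-1 * ((lq - lp) - ('[zq, q] - '[zp, p])).
    by move=> W nW; apply: oo_G; exact: xz.
  rewrite (cvg_unique (@norm_hausdorff _ _) (xp z) Fz).
  by rewrite (cvg_unique (@norm_hausdorff _ _) (xq z) Gz).
apply/eqP; rewrite -subr_eq0 -normr_le0 -(@ler_pXn2r _ 2) ?nnegrE // expr0n /=.
have : mu^-1 * `|p - q| ^+ 2 <= '[z, p - q].
  have lim : '[Q k (p - q), p - q] @[k --> \oo] --> '[z, p - q].
    by apply: cvg_inner => //; exact: cvg_cst.
  apply: (ler_cvg_to (cvg_cst _) lim); apply: nearW => k.
  rewrite ler_pdivrMl //.
  have := inv_quadratic_ge alpha0 (PU k) (QE k) (p - q).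
  by move=> /le_trans; apply; rewrite ler_wpM2r.
by rewrite innerDr innerNr !(innerC z) pqz subrr pmulr_rle0 // invr_gt0.
Qed.

End Iteration.

(** * Convergence *)

Theorem theorem3p2 (R : realType) (H : hilbertType R)
  (A : H -> set H) (hA : maximal_monotone A)
  (B : H -> H) (beta : R) (hbeta : 0 < beta) (hB : cocoercive beta B)
  (hOmega : zer (add_op A B) !=set0)
  (alpha : R) (halpha : 0 < alpha)
  (eta : nat -> R) (heta0 : forall k, 0 <= eta k) (heta : cvgn (series eta))
  (U : nat -> {linear H -> H}) (hU : forall k, Pclass alpha (U k))
  (hUbnd : has_ubound (range (fun k => opnorm (U k))))
  (mu : R) (hmu : mu = sup (range (fun k => opnorm (U k))))
  (hUmono : forall k, loewner_ge ((1 + eta k) \*: U k.+1) (U k))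
  (gamma : nat -> R)
  (hgamma : forall k, 0 < gamma k < 2 * beta / opnorm (U k))
  (alpha_ : nat -> R)
  (halpha_ : forall k,
    alpha_ k = 2 * beta / (4 * beta - gamma k * opnorm (U k)))
  (lambda : nat -> R) (hlambda : forall k, 0 < lambda k < 1 / alpha_ k)
  (a b : nat -> H)
  (ha : cvgn (series (fun k => lambda k * `|a k|)))
  (hb : cvgn (series (fun k => lambda k * `|b k|)))
  (x y : nat -> H)
  (hy : forall k, y k = x k - gamma k *: U k (B (x k) + b k))
  (hx : forall k, x k.+1 =
    x k + lambda k *:
      (resolvent (image_op (gamma k \*: U k) A) (y k) + a k - x k)) :
  (forall xs, zer (add_op A B) xs ->
     cvgn (fun k => wnorm (inv_op (U k)) (x k - xs)))
  /\
  (series (fun k => lambda k * (1 / alpha_ k - lambda k)) @ \oo --> +oo ->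
   (exists gamma_low eps : R,
      [/\ 0 < gamma_low, 0 < eps < 2 * beta - mu * gamma_low &
          forall k, gamma_low <= gamma k <= (2 * beta - eps) / mu]) ->
   cvgn (series (fun k => `|gamma k.+1 - gamma k|)) ->
   cvgn (series (fun k =>
     `|gamma k.+1 * opnorm (U k.+1) - gamma k * opnorm (U k)|)) ->
   (forall z : H, cvgn (series (fun k =>
     `|inv_op (U k) z - inv_op (U k.+1) z|))) ->
   [/\ `|x k - resolvent (image_op (gamma k \*: U k) A)
                 (x k - gamma k *: U k (B (x k)))| @[k --> \oo] --> (0 : R),
       exists2 p, zer (add_op A B) p & weak_cvg x p &
       (exists2 lambda_low : R, 0 < lambda_low &
          forall k, lambda_low <= lambda k) ->
       forall xs, zer (add_op A B) xs -> B (x k) @[k --> \oo] --> B xs]).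
Proof.
pose Q k := sval (cid (inv_op_linear halpha (hU k))).
have QE k : inv_op (U k) = Q k.
  exact: (svalP (cid (inv_op_linear halpha (hU k)))).
have b2 : 0 < 2 * beta by rewrite mulr_gt0.
have gamma0 k : 0 < gamma k by case/andP: (hgamma k).
have U_gt0 k : 0 < opnorm (U k).
  have : 0 <= opnorm (U k) by apply: opnorm_ge0; case: (hU k).
  rewrite le_eqVlt => /predU1P[U0|//].
  have /andP[g0] := hgamma k; rewrite -U0 invr0 mulr0 => g0'.
  by have := lt_trans g0 g0'; rewrite ltxx.
have gammaN k : gamma k * opnorm (U k) <= 2 * beta.
  by have /andP[_] := hgamma k; rewrite ltr_pdivlMr // => /ltW.
have alphaE k : 1 / alpha_ k = 2 - gamma k * opnorm (U k) / (2 * beta).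
  have := gammaN k; rewrite halpha_ => h; field.
  by rewrite !gt_eqF //; lra.
have lambda0 k : 0 <= lambda k by have /andP[/ltW] := hlambda k.
have lambda_lt k : lambda k <= 2 - gamma k * opnorm (U k) / (2 * beta).
  by rewrite -alphaE; have /andP[_ /ltW] := hlambda k.
have x_step k : x k.+1 = x k + lambda k *:
    (resolvent (image_op (gamma k \*: U k) A)
       (x k - gamma k *: U k (B (x k) + b k)) + a k - x k).
  by rewrite hx hy.
split=> [xs xsO|].
  have -> : (fun k => wnorm (inv_op (U k)) (x k - xs)) =
      (fun k => wnorm (Q k) (x k - xs)) by apply/funext => k; rewrite QE.
  exact (wnorm_dist_cvgn hA hbeta hB halpha heta0 heta hU QE hUmono gamma0
    gammaN lambda0 lambda_lt ha hb x_step xsO).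
move=> w_oo [gl [e [gl0 /andP[e0 _] gamma_b]]] _ _ Q_var.
have U_le k : opnorm (U k) <= mu.
  rewrite hmu; apply: sup_upper_bound; last by exists k.
  by split=> //; exists (opnorm (U 0%N)), 0%N.
have mu0 : 0 < mu by exact: lt_le_trans (U_gt0 0%N) (U_le 0%N).
have gl_le k : gl <= gamma k by case/andP: (gamma_b k).
have gu_ge k : gamma k <= (2 * beta - e) / mu by case/andP: (gamma_b k).
have kappa0 : 0 < e / (2 * beta) by rewrite divr_gt0.
have kappa_le k : e / (2 * beta) <= 1 - gamma k * opnorm (U k) / (2 * beta).
  rewrite lerBrDr -mulrDl ler_pdivrMr // mul1r.
  have : gamma k * opnorm (U k) <= gamma k * mu by rewrite ler_pM2l.
  by have := gu_ge k; rewrite ler_pdivlMr //; lra.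
have lambda_oo : series lambda @ \oo --> +oo.
  apply/cvgryPge => r; move/cvgryPge: w_oo => /(_ (2 * r)); apply: filterS => n.
  have : series (fun k => lambda k * (1 / alpha_ k - lambda k)) n <=
      2 * series lambda n.
    rewrite /series /= mulr_sumr; apply: ler_sum => k _.
    rewrite mulrC ler_wpM2r // alphaE.
    have : 0 <= gamma k * opnorm (U k) / (2 * beta).
      by rewrite divr_ge0 ?mulr_ge0 // ltW.
    by have := lambda0 k; lra.
  by lra.
have Q_cvg z : cvgn (fun k => Q k z).
  have := normed_cvg (Q_var z); set u := (fun k => _) => u_cvg.
  have -> : (fun k => Q k z) = (fun k => Q 0%N z - series u k).
    apply/funext; elim=> [|k IHk]; first by rewrite /series /= big_geq // subr0.
    by rewrite seriesSr opprD addrA -IHk /u !QE opprB addrC subrK.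
  by apply: is_cvgB => //; exact: is_cvg_cst.
have [xs xsO] := hOmega.
have v0 : (fun k => `|residual A B gamma U x k|) @ \oo --> (0 : R).
  exact (residual_cvg0 hA hbeta hB halpha heta0 heta hU QE hUmono gamma0
    gammaN lambda0 lambda_lt ha hb x_step xsO mu0 U_le gl0 gl_le gu_ge kappa0
    kappa_le lambda_oo).
have B_cvg xs' (xs'O : zer (add_op A B) xs') : B (x k) @[k --> \oo] --> B xs'.
  exact (forward_cvg hA hbeta hB halpha heta0 heta hU QE hUmono gamma0
    gammaN lambda0 lambda_lt ha hb x_step xs'O U_le gl0 gl_le v0).
split=> //.
have [X _ xX] := iterates_bounded hA hbeta hB halpha heta0 heta hU QE hUmono
  gamma0 gammaN lambda0 lambda_lt ha hb x_step xsO U_le.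
have xM k : `|x k| <= X + `|xs|.
  by rewrite -[x k](subrK xs) (le_trans (ler_normD _ _)) // lerD2r.
have zer_lim F q : UltraFilter F -> \oo `<=` F -> weak_lim F x q ->
    zer (add_op A B) q.
  move=> FU oo_F xq.
  exact (weak_limit_zer hA hbeta hB halpha heta0 heta hU QE hUmono gamma0
    gammaN lambda0 lambda_lt ha hb x_step xsO U_le gl0 gl_le ultra_proper oo_F
    v0 xq).
have [F [FU oo_F]] := ultraFilterLemma (eventually_filter : ProperFilter \oo).
have [p xp] := ultra_weak_lim FU xM.
have pO := zer_lim F p FU oo_F xp.
exists p => //; apply: (weak_cvg_ultra xM) => G q GU oo_G xq.
have qO := zer_lim G q GU oo_G xq.
exact (weak_limits_eq hA hbeta hB halpha heta0 heta hU QE hUmono gamma0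
  gammaN lambda0 lambda_lt ha hb x_step mu0 U_le Q_cvg qO pO ultra_proper
  ultra_proper oo_G oo_F xq xp).
Qed.
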